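(* There is an absolute constant $C>0$ such that, for every finite field $\mathbb{F}_q$ of characteristic not equal to $2$, $$\sum_{x\in V(\mathbb{F}_q)}|\widehat{\Psi_q}(x)|\le C q^4,$$ where $V(\mathbb{F}_q)=\mathbb{F}_q^2\otimes\mathrm{Sym}^2(\mathbb{F}_q^3)$ is the space of pairs of ternary quadratic forms over $\mathbb{F}_q$ and $\Psi_q\colon V(\mathbb{F}_q)\to\{0,1\}$ is the characteristic function of the singular elements.
   Context: $p=\mathrm{char}(\mathbb{F}_q)\neq2$. Elements of $V(\mathbb{F}_q)$ are pairs $x=(A,B)$ of ternary quadratic forms over $\mathbb{F}_q$, also regarded as pairs of symmetric $3\times3$ matrices. The cubic resolvent of $x$ is the binary cubic form $r_x(u,v)=-4\det(Au+Bv)$; $\mathrm{Disc}(x)$ is the discriminant of $r_x$ (the discriminant of $au^3+bu^2v+cuv^2+dv^3$ is $b^2c^2+18abcd-4ac^3-4b^3d-27a^2d^2$), and $x$ is singular if $\mathrm{Disc}(x)=0$. For ternary forms $A=au^2+buv+cuw+dv^2+evw+fw^2$ and $A'$ (coefficients $a',\dots,f'$), put $[A,A']'=aa'+bb'/2+cc'/2+dd'+ee'/2+ff'$, and $[(A,B),(A',B')]=[A,A']'+[B,B']'$. For $\Phi\colon V(\mathbb{F}_q)\to\mathbb{C}$, $$\widehat\Phi(y)=q^{-12}\sum_{x\in V(\mathbb{F}_q)}\Phi(x)\exp\left(2\pi\sqrt{-1}\cdot\mathrm{Tr}_{\mathbb{F}_q/\mathbb{F}_p}([x,y])/p\right).$$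 *)

(* Defs.v *)
From HB Require Import structures.
From mathcomp Require Import all_boot all_order all_algebra all_field.
From mathcomp Require Import complex ring.
From mathcomp Require Import reals sequences trigo.

Set Implicit Arguments.
Unset Strict Implicit.
Unset Printing Implicit Defensive.

Import Order.TTheory GRing.Theory Num.Theory.

Local Open Scope ring_scope.
Local Open Scope complex_scope.

(* The row (a, b, c, d, e, f) stands for the ternary quadratic form
   a u^2 + b uv + c uw + d v^2 + e vw + f w^2. *)
Notation tqform F := 'rV[F]_6.
Notation tqpair F := (tqform F * tqform F)%type.

Section Forms.
Variable F : fieldType.
Implicit Types (A B : tqform F) (x y : tqpair F).

Definition tqcoef A (k : nat) : F := A 0 (inord k).

Definition tqeval A (u v w : F) : F :=
  tqcoef A 0 * u ^+ 2 + tqcoef A 1 * u * v + tqcoef A 2 * u * w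
  + tqcoef A 3 * v ^+ 2 + tqcoef A 4 * v * w + tqcoef A 5 * w ^+ 2.

(* Meaningful in characteristic different from 2 only; see tqmxP. *)
Definition tqmx A : 'M[F]_3 :=
  let a := tqcoef A 0 in let b := tqcoef A 1 in let c := tqcoef A 2 in
  let d := tqcoef A 3 in let e := tqcoef A 4 in let f := tqcoef A 5 in
  \matrix_(i, j) nth 0 (nth [::]
    [:: [:: a;     b / 2; c / 2];
        [:: b / 2; d;     e / 2];
        [:: c / 2; e / 2; f    ]] i) j.

Lemma tqmx_sym A : (tqmx A)^T = tqmx A.
Proof.
by apply/matrixP; case=> [[|[|[|i]]] hi] //; case=> [[|[|[|j]]] hj] //;
  rewrite !mxE.
Qed.

Lemma tqmxP A (u : 'rV[F]_3) : (2 : F) != 0 ->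
  (u *m tqmx A *m u^T) 0 0 =
  tqeval A (u 0 (inord 0)) (u 0 (inord 1)) (u 0 (inord 2)).
Proof.
move=> n2; rewrite /tqeval !mxE.
have E (f : 'I_3 -> F) :
    \sum_(i < 3) f i = f (inord 0) + f (inord 1) + f (inord 2).
  rewrite !big_ord_recl big_ord0 addr0 addrA.
  by congr (f _ + f _ + f _); apply/val_inj; rewrite /= inordK.
rewrite E !mxE !E !mxE !inordK //=.
by field.
Qed.

(* Binary cubic forms in u, v are elements of {poly {poly F}}, where u is the
   outer variable 'X and v is the inner one, 'X%:P. *)
Definition resolvent x : {poly {poly F}} :=
  - 4%:R * \det ('X *: map_mx (polyC \o polyC) (tqmx x.1)
                 + ('X)%:P *: map_mx (polyC \o polyC) (tqmx x.2)).

Definition cubic_disc (r : {poly {poly F}}) : F :=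
  let a := r`_3`_0 in let b := r`_2`_1 in
  let c := r`_1`_2 in let d := r`_0`_3 in
  b ^+ 2 * c ^+ 2 + 18%:R * a * b * c * d - 4%:R * a * c ^+ 3
  - 4%:R * b ^+ 3 * d - 27%:R * a ^+ 2 * d ^+ 2.

Lemma cubic_discE (a b c d : F) :
  cubic_disc (a%:P%:P * 'X^3 + b%:P%:P * 'X^2 * ('X)%:P
              + c%:P%:P * 'X * ('X)%:P ^+ 2 + d%:P%:P * ('X)%:P ^+ 3)
  = b ^+ 2 * c ^+ 2 + 18%:R * a * b * c * d - 4%:R * a * c ^+ 3
    - 4%:R * b ^+ 3 * d - 27%:R * a ^+ 2 * d ^+ 2.
Proof.
rewrite /cubic_disc -!rmorphXn.
do !rewrite ?(coefD, coefMC, coefCM, coefXn, coefX, coefC) /=.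
by rewrite ?(mulr0, mulr1, mul0r, mul1r, add0r, addr0, coef0, coefD, coefMC,
  coefCM, coefXn, coefX, coefC) /= ?(mulr0, mulr1, mul0r, mul1r, add0r, addr0).
Qed.

Definition Disc x : F := cubic_disc (resolvent x).

Definition singular x : bool := Disc x == 0.

Definition tqbracket1 A B : F :=
  tqcoef A 0 * tqcoef B 0 + tqcoef A 1 * tqcoef B 1 / 2
  + tqcoef A 2 * tqcoef B 2 / 2 + tqcoef A 3 * tqcoef B 3
  + tqcoef A 4 * tqcoef B 4 / 2 + tqcoef A 5 * tqcoef B 5.

Definition tqbracket x y : F := tqbracket1 x.1 y.1 + tqbracket1 x.2 y.2.

End Forms.

Section Trace.
Variables (F : finFieldType) (p : nat) (pcharF : p \in [pchar F]).

(* F viewed as a (splitting field) extension of 'F_p. *)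
Notation Fp := (pPrimeCharType pcharF).

(* The Galois trace is an element of F lying in the prime field; it is read
   back in 'F_p, the default value being irrelevant by FpTraceE. *)
Definition FpTrace (a : F) : 'F_p :=
  odflt 0 [pick k : 'F_p | (k%:A : Fp) == galTrace 1%VS {:Fp}%VS (a : Fp)].

Lemma FpTraceE (a : F) :
  ((FpTrace a)%:A : Fp) = galTrace 1%VS {:Fp}%VS (a : Fp).
Proof.
rewrite /FpTrace; case: pickP => [k /eqP //|no].
have gal : galois 1%AS {:Fp}%AS := finField_galois (sub1v _).
have := mem_galTrace gal (memvf (a : Fp)).
by case/vlineP=> k Ek; have := no k; rewrite -Ek eqxx.
Qed.

End Trace.

Section Fourier.
Variable R : realType.

Definition cexp (z : R[i]) : R[i] :=
  let: a +i* b := z in (expR a)%:C * (cos b +i* sin b).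

Variables (F : finFieldType) (p : nat) (pcharF : p \in [pchar F]).

Definition fourier (Phi : tqpair F -> R[i]) (y : tqpair F) : R[i] :=
  (#|F|%:R ^+ 12)^-1 *
  \sum_(x : tqpair F)
    Phi x * cexp (2 * (pi : R)%:C * 'i
                  * (FpTrace pcharF (tqbracket x y) : nat)%:R / p%:R).

Definition singular_char (x : tqpair F) : R[i] := (singular x)%:R.

End Fourier.

(* Main.v *)
Require Import Defs.
From mathcomp Require Import all_boot all_order all_algebra all_field.
From mathcomp Require Import complex reals.
From mathcomp Require Import all_fingroup mxabelem sequences exp trigo ring zify.

Set Implicit Arguments.
Unset Strict Implicit.
Unset Printing Implicit Defensive.

Import Order.TTheory GRing.Theory Num.Theory.

Local Open Scope ring_scope.
Local Open Scope complex_scope.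

(** Write [Psi] for the indicator function of the singular pairs and call the
    sum of the absolute values of a Fourier transform its spectral norm
    ([wnorm]).  It is a norm, and the indicator function of an additive
    subgroup has norm exactly 1 ([wnorm_subgroup]): its transform is a
    nonnegative multiple of the indicator function of the annihilator, so the
    norm is the sum of the transform, which is the value at 0 by inversion.
    Hence it is enough to write [Psi] as a combination of indicator functions
    of linear subspaces whose coefficients have absolute values adding up to
    O(q^4).

    Let [x = (A, B)], let [r(s, t) = det(sA + tB)], and let [D_l(x)] say that
    [l = (s, t) != 0] is a multiple zero of [r].  If [r != 0], then [x] is
    singular exactly when [r] has a multiple zero, which is then rational (a
    finite field is perfect) and unique up to scaling; if [r = 0], every [l]
    is one.  So ([singular_count], [card_dblroot])
      (q - 1) (Psi + q [r = 0]) = sum of the D_l over l != 0.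

    For fixed [l] put [P = sA + tB].  Since the adjugate of a rank-two
    symmetric matrix is a nonzero multiple of [e^T e], with [e] spanning the kernel,
    [D_l] says that [P] has rank at most 1, or has rank 2 and the two conics
    pass through its vertex.  [dbl_pencil_indicator] turns this into linear
    conditions by inclusion-exclusion over points [e], lines [f] and incident
    pairs [(e, f)] of the projective plane.  There are q^3 flags, but the
    sums over them cancel exactly the excess produced by the points and lines
    when the rank of [P] is 0 or 1.

    A pencil of conics consisting of singular conics has a common vertex or a
    common line component ([component_exists], a theorem of Bertini), and
    again the pencils having both are removed by a sum over flags
    ([zero_pencil_indicator]); only [x = 0] needs a correction, q^3 times the
    indicator function of the zero subspace.

    Counting vectors in place of projective points multiplies each identity
    by a power of q - 1, and summing up gives norm at most 24 q^3 for [D_l]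
    and for [r = 0], hence 96 q^4 for [Psi]. *)

(** * The additive character given by the trace *)

Section TraceCharacter.
Variables (F : finFieldType) (p : nat) (pcharF : p \in [pchar F]).
Notation Fp := (pPrimeCharType pcharF).

Lemma FpTraceD : {morph FpTrace pcharF : a b / a + b}.
Proof.
move=> a b; apply: (fmorph_inj (in_alg Fp)) => /=.
by rewrite scalerDl !FpTraceE -raddfD.
Qed.

(** Automorphisms of a field are linearly independent, and the trace is the
    sum of all of them. *)
Lemma FpTrace_neq0 : exists a, FpTrace pcharF a != 0.
Proof.
have [|a _ nz] := @gal_independent_contra _ _ {:Fp}%AS
  (mem 'Gal({:Fp} / 1)%g) (fun=> 1) 1%g (group1 _); first exact: oner_neq0.
exists a; apply: contraNneq nz => tr0.
rewrite (eq_bigr (fun x : gal_of _ => x a)) => [|x _]; last by rewrite mul1r.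
have := FpTraceE pcharF a; rewrite tr0 scale0r => E.
by apply/eqP; symmetry.
Qed.

End TraceCharacter.

Section UnitCircle.
Variable R : realType.
Implicit Types (t : R) (n k : nat).

Definition cis t : R[i] := cos t +i* sin t.

Lemma cisD t u : cis (t + u) = cis t * cis u.
Proof.
by rewrite /cis; simpc; rewrite cosD sinD [sin t * _ + _]addrC.
Qed.

Lemma cis_period t n : cis (t + n%:R * (2 * pi)) = cis t.
Proof.
have -> : n%:R * (2 * pi) = (pi *+ 2) *+ n :> R by rewrite !mulr_natl.
by rewrite /cis (periodicn (@cosD2pi R)) (periodicn (@sinD2pi R)).
Qed.

(** The sine is positive or negative according to the half turn that [k / n]
    falls in; [n] odd excludes the half turn itself. *)
Lemma cis_neq1 k n : (0 < k < n)%N -> odd n ->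
  cis (k%:R / n%:R * (2 * pi)) != 1.
Proof.
case/andP=> k_gt0 ltkn n_odd; have n_gt0 : (0 < n)%N by case: (n) n_odd.
have nR : 0 < n%:R :> R by rewrite ltr0n.
have kR : 0 < k%:R :> R by rewrite ltr0n.
have pi0 := pi_gt0 R.
apply/eqP=> -[_ s0].
have [lt2kn|] := ltnP k.*2 n.
  suff : 0 < sin (k%:R / n%:R * (2 * pi) : R) by rewrite s0 ltxx.
  apply: sin_gt0_pi; rewrite !mulr_gt0 ?invr_gt0 //=.
  rewrite mulrAC ltr_pdivrMr // mulrA [ltRHS]mulrC ltr_pM2r //.
  by rewrite -natrM muln2 ltr_nat.
rewrite leq_eqVlt => /predU1P[n2k|lt2kn].
  by rewrite n2k odd_double in n_odd.
suff : 0 < sin (k%:R / n%:R * (2 * pi) - pi : R).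
  by rewrite -oppr_lt0 -sinDpi subrK s0 ltxx.
have -> : k%:R / n%:R * (2 * pi) - pi = (k.*2 - n)%N%:R / n%:R * pi :> R.
  by rewrite natrB ?(ltnW lt2kn) // -muln2 natrM; field; rewrite gt_eqF.
apply: sin_gt0_pi; rewrite !mulr_gt0 ?invr_gt0 ?ltr0n ?subn_gt0 //=.
rewrite -[ltRHS]mul1r ltr_pM2r // ltr_pdivrMr // mul1r ltr_nat.
by rewrite ltn_subLR ?(ltnW lt2kn) // addnn ltn_double.
Qed.

End UnitCircle.

Section Character.
Variables (R : realType) (F : finFieldType) (p : nat).
Variable pcharF : p \in [pchar F].

Let p_pr : prime p. Proof. exact: pcharf_prime pcharF. Qed.

Definition fchar (a : F) : R[i] :=
  cexp (2 * (pi : R)%:C * 'i * (FpTrace pcharF a : nat)%:R / p%:R).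

Lemma fcharE a :
  fchar a = cis ((FpTrace pcharF a : nat)%:R / p%:R * (2 * pi)).
Proof.
rewrite /fchar; set k := nat_of_ord _.
have -> : 2 * (pi : R)%:C * 'i * k%:R / p%:R =
    0 +i* (k%:R / p%:R * (2 * pi)) :> R[i].
  have nC n : n%:R = (n%:R)%:C :> R[i] by rewrite rmorph_nat.
  rewrite [RHS](_ : _ = (k%:R / p%:R * (2 * pi))%:C * 'i); last by simpc.
  rewrite !rmorphM fmorphV !rmorph_nat.
  ring.
by rewrite /cexp expR0 mul1r.
Qed.

(** The residues add up modulo [p] only, which the period of the circle absorbs. *)
Lemma fcharD a b : fchar (a + b) = fchar a * fchar b.
Proof.
rewrite !fcharE FpTraceD -cisD -mulrDl -mulrDl -natrD.
set k := FpTrace _ a; set l := FpTrace _ b.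
have [m E] : exists m, (k + l = (k + l)%R + m * p :> nat)%N.
  exists ((k + l)%N %/ p)%N.
  rewrite {1}(divn_eq (k + l)%N p) addnC /=; congr (_ + _)%N.
  exact: (congr1 (modn _) (esym (Fp_cast p_pr))).
rewrite E natrD natrM [(_ + _) / _]mulrDl mulfK ?[(_ + m%:R) * _]mulrDl ?cis_period //.
by rewrite pnatr_eq0 -lt0n prime_gt0.
Qed.

Lemma fchar0 : fchar 0 = 1.
Proof.
have tr0 : FpTrace pcharF 0 = 0.
  by apply: (addrI (FpTrace pcharF 0)); rewrite -FpTraceD !addr0.
by rewrite fcharE tr0 !mul0r /cis cos0 sin0.
Qed.

Lemma fchar_nontriv : p != 2%N -> exists a, fchar a != 1.
Proof.
move=> p_neq2; have [a nz] := FpTrace_neq0 pcharF; exists a; rewrite fcharE.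
apply: cis_neq1; last by case: (even_prime p_pr) p_neq2 => // ->.
rewrite lt0n; apply/andP; split; first exact: nz.
by rewrite -[X in (_ < X)%N]Fp_cast.
Qed.

End Character.

(** * The spectral norm *)

Section SubgroupSum.
Variables (F : finFieldType) (C : idomainType).
Notation V := (tqpair F).
Variable chi : V -> C.
Hypothesis chiD : {morph chi : x y / x + y >-> x * y}.

(** If [chi w != 1] for some [w] in [W], translation by [w] multiplies the sum by
    [chi w]. *)
Lemma subgroup_sum (W : {pred V}) : zmod_closed W ->
  \sum_(x in W) chi x = if [forall x in W, chi x == 1] then #|W|%:R else 0.
Proof.
move=> Wcl; have [W0 WB] := Wcl.
case: ifPn => [/eqfun_inP chi1|]; first by rewrite (eq_bigr (fun=> 1)) // sumr_const.
case/forall_inPn => w Ww chiw.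
have WN x : x \in W -> - x \in W by move=> Wx; rewrite -sub0r WB.
have WD x y : x \in W -> y \in W -> x + y \in W.
  by move=> Wx Wy; rewrite -[y]opprK WB ?WN.
set S := \sum_(x in W) _; have E : chi w * S = S.
  rewrite mulr_sumr [RHS](reindex_inj (addrI w)) /=.
  apply: eq_big => [x|x _]; last by rewrite chiD.
  by apply/idP/idP => [/(WD _ _ Ww)//|/WB/(_ Ww)]; rewrite addrC addKr.
have /eqP : (chi w - 1) * S = 0 by rewrite mulrBl mul1r E subrr.
by rewrite mulf_eq0 subr_eq0 (negPf chiw) => /eqP.
Qed.

End SubgroupSum.

Section Bracket.
Variable F : fieldType.
Implicit Types (x y : tqpair F) (A B : tqform F).

Lemma tqbracketDl y : {morph (fun x => tqbracket x y) : x x' / x + x'}.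
Proof.
by move=> x x'; rewrite /tqbracket /tqbracket1 /tqcoef /= !mxE; ring.
Qed.

Lemma tqbracketDr x : {morph (fun y => tqbracket x y) : y y' / y + y'}.
Proof.
by move=> y y'; rewrite /tqbracket /tqbracket1 /tqcoef /= !mxE; ring.
Qed.

(** The coefficients of the diagonal bilinear form [tqbracket1]. *)
Definition tqweight (i : 'I_6) : F := nth 0 [:: 1; 2^-1; 2^-1; 1; 2^-1; 1] i.

Lemma tqbracket1E A B :
  tqbracket1 A B = \sum_i tqweight i * (A 0 i * B 0 i).
Proof.
have E (f : 'I_6 -> F) : \sum_i f i = f (inord 0) + f (inord 1) + f (inord 2)
    + f (inord 3) + f (inord 4) + f (inord 5).
  rewrite !big_ord_recl big_ord0 addr0 !addrA.
  by congr (f _ + f _ + f _ + f _ + f _ + f _); apply/val_inj; rewrite /= inordK.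
by rewrite E /tqweight !inordK //= /tqbracket1 /tqcoef; ring.
Qed.

Lemma tqbracket1_surj A a : (2 : F) != 0 -> A != 0 ->
  exists B, tqbracket1 A B = a.
Proof.
move=> F2 /rV0Pn[i Ai]; have wi : tqweight i != 0.
  by case: i {Ai} => [[|[|[|[|[|[|]]]]]] // ?]; rewrite /tqweight /= ?oner_eq0 ?invr_eq0.
exists ((a / (tqweight i * A 0 i)) *: delta_mx 0 i).
rewrite tqbracket1E (bigD1 i) //= big1 => [|j ji]; last first.
  by rewrite !mxE eqxx (negPf ji) !mulr0.
by rewrite !mxE !eqxx /=; field; rewrite wi Ai.
Qed.

(** The bracket is nondegenerate, so [tqbracket x] is onto as soon as it is
    nonzero. *)
Lemma tqbracket_surj x a : (2 : F) != 0 -> x != 0 ->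
  exists y, tqbracket x y = a.
Proof.
have b0 A : tqbracket1 A 0 = 0.
  by rewrite tqbracket1E big1 // => i _; rewrite mxE !mulr0.
case: x => A A' F2; rewrite -pair_eqE negb_and => /orP[] /= nz.
  have [B EB] := tqbracket1_surj a F2 nz.
  by exists (B, 0); rewrite /tqbracket /= b0 addr0.
have [B EB] := tqbracket1_surj a F2 nz.
by exists (0, B); rewrite /tqbracket /= b0 add0r.
Qed.

End Bracket.

Section Wiener.
Variables (R : realType) (F : finFieldType) (p : nat).
Variable pcharF : p \in [pchar F].
Implicit Types Phi Psi : tqpair F -> R[i].

Definition wnorm Phi : R[i] := \sum_(y : tqpair F) `|fourier pcharF Phi y|.

Lemma eq_wnorm Phi Psi : Phi =1 Psi -> wnorm Phi = wnorm Psi.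
Proof.
move=> eqPhi; apply: eq_bigr => y _; congr (`|_ * _|).
by apply: eq_bigr => x _; rewrite eqPhi.
Qed.

Lemma wnormZ c Phi : wnorm (fun x => c * Phi x) = `|c| * wnorm Phi.
Proof.
rewrite mulr_sumr; apply: eq_bigr => y _.
rewrite -normrM /fourier mulrCA; congr (`|_ * _|).
by rewrite mulr_sumr; apply: eq_bigr => x _; rewrite mulrA.
Qed.

Lemma fourier_sum (I : finType) (P : pred I) (Phi_ : I -> tqpair F -> R[i]) y :
  fourier pcharF (fun x => \sum_(i | P i) Phi_ i x) y =
  \sum_(i | P i) fourier pcharF (Phi_ i) y.
Proof.
rewrite -mulr_sumr exchange_big /=; congr (_ * _).
by apply: eq_bigr => x _; rewrite mulr_suml.
Qed.

Lemma fourierD Phi Psi y :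
  fourier pcharF (fun x => Phi x + Psi x) y =
  fourier pcharF Phi y + fourier pcharF Psi y.
Proof.
rewrite -mulrDr -big_split /=; congr (_ * _).
by apply: eq_bigr => x _; rewrite mulrDl.
Qed.

Lemma wnorm_sum (I : finType) (P : pred I) (Phi_ : I -> tqpair F -> R[i]) :
  wnorm (fun x => \sum_(i | P i) Phi_ i x) <= \sum_(i | P i) wnorm (Phi_ i).
Proof.
rewrite exchange_big /=; apply: ler_sum => y _.
by rewrite fourier_sum ler_norm_sum.
Qed.

Lemma wnormD Phi Psi :
  wnorm (fun x => Phi x + Psi x) <= wnorm Phi + wnorm Psi.
Proof.
by rewrite -big_split /=; apply: ler_sum => y _; rewrite fourierD ler_normD.
Qed.

Hypothesis p_neq2 : p != 2%N.
Lemma two_neq0 : (2 : F) != 0.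
Proof.
rewrite -(dvdn_pcharf pcharF); apply: contra p_neq2.
by rewrite dvdn_prime2 ?(pcharf_prime pcharF).
Qed.

Notation "e( a )" := (fchar R pcharF a).

Lemma fourierE Phi y :
  fourier pcharF Phi y =
  (#|F|%:R ^+ 12)^-1 * \sum_x Phi x * e(tqbracket x y).
Proof. by []. Qed.

Lemma card_tqpair : #|{: tqpair F}| = (#|F| ^ 12)%N.
Proof. by rewrite card_prod !card_mx -expnD. Qed.

Lemma sum_fchar_bracket x :
  \sum_(y : tqpair F) e(tqbracket x y) = if x == 0 then #|F|%:R ^+ 12 else 0.
Proof.
have chiD : {morph (fun y : tqpair F => e(tqbracket x y)) :
    y y' / y + y' >-> y * y'}.
  by move=> y y' /=; rewrite tqbracketDr fcharD.
have := subgroup_sum chiD (W := predT) _; rewrite -natrX -card_tqpair => -> //.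
case: eqVneq => [->|nz].
  suff -> : [forall y in predT, e(tqbracket 0 y) == 1] by [].
  apply/eqfun_inP => y _; have /= := tqbracketDl y 0 0.
  by rewrite addr0 -[X in X = _]addr0 => /addrI<-; rewrite fchar0.
case: eqfun_inP => // triv; have [a] := fchar_nontriv R pcharF p_neq2.
by have [y <-] := tqbracket_surj a two_neq0 nz; rewrite triv ?eqxx.
Qed.

(** Fourier inversion at the origin: summing the characters over [y] isolates [x = 0]. *)
Lemma fourier_inv0 Phi : \sum_y fourier pcharF Phi y = Phi 0.
Proof.
rewrite -mulr_sumr exchange_big /=.
under eq_bigr => x _ do rewrite -mulr_sumr [X in _ * X]sum_fchar_bracket.
rewrite (bigD1 (0 : tqpair F)) //= eqxx big1 => [|x /negPf->]; last by rewrite mulr0.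
rewrite addr0 mulrCA mulVf ?mulr1 // expf_neq0 // pnatr_eq0 -lt0n.
by apply/card_gt0P; exists 0.
Qed.

(** The transform takes nonnegative values, being proportional to a character sum
    over a subgroup; inversion at 0 then computes its sum. *)
Lemma wnorm_subgroup (W : {pred tqpair F}) : zmod_closed W ->
  wnorm (fun x => (x \in W)%:R) = 1.
Proof.
move=> Wcl; have [W0 _] := Wcl.
rewrite -[RHS](_ : (0 \in W)%:R = 1); last by rewrite W0.
rewrite -[RHS](fourier_inv0 (fun x => (x \in W)%:R)).
apply: eq_bigr => y _; apply: ger0_norm.
rewrite fourierE mulr_ge0 ?invr_ge0 ?exprn_ge0 //.
rewrite (eq_bigr (fun x => if x \in W then e(tqbracket x y) else 0)) => [|x _].
  rewrite -big_mkcond /= subgroup_sum //; first by case: ifP.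
  by move=> x x' /=; rewrite tqbracketDl fcharD.
by case: ifP; rewrite ?mul1r ?mul0r.
Qed.

End Wiener.

(** * Multiple zeros of binary cubic forms *)

Section BinaryCubic.
Variable F : finFieldType.
Hypothesis F2 : (2 : F) != 0.
Variables a b c d : F.

Definition cub (l : F * F) :=
  a * l.1 ^+ 3 + b * l.1 ^+ 2 * l.2 + c * l.1 * l.2 ^+ 2 + d * l.2 ^+ 3.
Definition cub_u (l : F * F) := 3 * a * l.1 ^+ 2 + 2 * b * l.1 * l.2 + c * l.2 ^+ 2.
Definition cub_v (l : F * F) := b * l.1 ^+ 2 + 2 * c * l.1 * l.2 + 3 * d * l.2 ^+ 2.

(** The vanishing of the form is a separate condition because in characteristic 3 it
    does not follow from that of the partial derivatives by Euler's identity. *)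
Definition dblroot l := [&& cub l == 0, cub_u l == 0 & cub_v l == 0].

Definition bcdisc :=
  b ^+ 2 * c ^+ 2 + 18%:R * a * b * c * d - 4%:R * a * c ^+ 3
  - 4%:R * b ^+ 3 * d - 27%:R * a ^+ 2 * d ^+ 2.

Definition cub0 := [&& a == 0, b == 0, c == 0 & d == 0].

Lemma dblrootZ k s t : dblroot (s, t) -> dblroot (k * s, k * t).
Proof.
case/and3P=> /eqP /= r /eqP /= ru /eqP /= rv; apply/and3P; split; apply/eqP.
- by transitivity (k ^+ 3 * cub (s, t)); [rewrite /cub /=; ring | rewrite r mulr0].
- by transitivity (k ^+ 2 * cub_u (s, t)); [rewrite /cub_u /=; ring | rewrite ru mulr0].
- by transitivity (k ^+ 2 * cub_v (s, t)); [rewrite /cub_v /=; ring | rewrite rv mulr0].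
Qed.

(** In the coordinates of two independent multiple zeros, all four coefficients of
    the form vanish; the cube of the determinant [D] is the price of changing
    back. *)
Lemma dblroot_uniq s t s' t' : dblroot (s, t) -> dblroot (s', t') ->
  s * t' - t * s' != 0 -> cub0.
Proof.
case/and3P=> /eqP r /eqP ru /eqP rv /and3P[/eqP r' /eqP ru' /eqP rv'].
set D := _ - _ => D0.
have e1 : s' * cub_u (s, t) + t' * cub_v (s, t) = 0.
  by rewrite ru rv !mulr0 addr0.
have e2 : s * cub_u (s', t') + t * cub_v (s', t') = 0.
  by rewrite ru' rv' !mulr0 addr0.
have D3 x : D ^+ 3 * x = 0 -> x == 0.
  by move/eqP; rewrite mulf_eq0 expf_eq0 (negPf D0).
have comb k0 k1 k2 k3 : k0 * cub (s, t)
    + k1 * (s' * cub_u (s, t) + t' * cub_v (s, t))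
    + k2 * (s * cub_u (s', t') + t * cub_v (s', t')) + k3 * cub (s', t') = 0.
  by rewrite r e1 e2 r' !mulr0 !addr0.
(* The multipliers are the coefficients of the inverse linear substitution. *)
apply/and4P; split; apply: D3.
- rewrite -(comb (t' ^+ 3) (- (t' ^+ 2 * t)) (t' * t ^+ 2) (- t ^+ 3)).
  by rewrite /D /cub /cub_u /cub_v /=; ring.
- rewrite -(comb (- 3 * t' ^+ 2 * s') (t' ^+ 2 * s + 2 * t' * s' * t)
    (- (s' * t ^+ 2 + 2 * t' * t * s)) (3 * t ^+ 2 * s)).
  by rewrite /D /cub /cub_u /cub_v /=; ring.
- rewrite -(comb (3 * t' * s' ^+ 2) (- (s' ^+ 2 * t + 2 * t' * s' * s))
    (t' * s ^+ 2 + 2 * s' * t * s) (- 3 * t * s ^+ 2)).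
  by rewrite /D /cub /cub_u /cub_v /=; ring.
- rewrite -(comb (- s' ^+ 3) (s' ^+ 2 * s) (- (s' * s ^+ 2)) (s ^+ 3)).
  by rewrite /D /cub /cub_u /cub_v /=; ring.
Qed.

(** Dehomogenise at a nonzero coordinate; the vanishing of the form and of one partial
    derivative expresses two coefficients by the other two. *)
Lemma dblroot_disc l : l != 0 -> dblroot l -> bcdisc = 0.
Proof.
case: l => s t; rewrite -pair_eqE negb_and /= => nz.
case/and3P=> /eqP; rewrite /cub /cub_u /cub_v /= => r /eqP ru /eqP rv.
case/orP: nz => nz.
- set x := t / s; have Et : t = x * s by rewrite /x divfK.
  rewrite Et in r ru rv.
  have Eb : b = - 2 * c * x - 3 * d * x ^+ 2.
    apply: (mulIf (expf_neq0 2 nz)); apply/eqP; rewrite -subr_eq0 -rv.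
    by apply/eqP; ring.
  have Ea : a = - b * x - c * x ^+ 2 - d * x ^+ 3.
    apply: (mulIf (expf_neq0 3 nz)); apply/eqP; rewrite -subr_eq0 -r.
    by apply/eqP; ring.
  by rewrite /bcdisc Ea Eb; ring.
- set x := s / t; have Et : s = x * t by rewrite /x divfK.
  rewrite Et in r ru rv.
  have Ec : c = - 2 * b * x - 3 * a * x ^+ 2.
    apply: (mulIf (expf_neq0 2 nz)); apply/eqP; rewrite -subr_eq0 -ru.
    by apply/eqP; ring.
  have Ed : d = - c * x - b * x ^+ 2 - a * x ^+ 3.
    apply: (mulIf (expf_neq0 3 nz)); apply/eqP; rewrite -subr_eq0 -r.
    by apply/eqP; ring.
  by rewrite /bcdisc Ed Ec; ring.
Qed.

(** If [b = c = 0] the form is a cube, because the Frobenius is onto.  Otherwise both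
    partial derivatives vanish at [(c, b)], where the form takes the value
    [- bcdisc]. *)
Lemma dblroot_ex_char3 : (3 : F) = 0 -> bcdisc = 0 ->
  exists2 l, l != 0 & dblroot l.
Proof.
move=> F3 disc0.
have [/andP[/eqP b0 /eqP c0]|bc] := boolP ((b == 0) && (c == 0)).
  have ch3 : 3%N \in [pchar F] by rewrite inE /= F3 eqxx.
  have cubeI : injective (fun x : F => x ^+ 3).
    exact: (fmorph_inj (pFrobenius_aut ch3)).
  have [g _ gK] := injF_bij cubeI.
  have [/andP[/eqP a0 /eqP d0]|ad] := boolP ((a == 0) && (d == 0)).
    exists (1, 0); first by rewrite -pair_eqE /= oner_eq0.
    by rewrite /dblroot /cub /cub_u /cub_v /= a0 b0 c0 d0; do !rewrite ?mulr0 ?mul0r ?addr0 ?eqxx.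
  exists (g d, - g a).
    rewrite -pair_eqE /= oppr_eq0; apply: contra ad => /andP[/eqP gd0 /eqP ga0].
    by rewrite -[a]gK -[d]gK gd0 ga0 expr0n eqxx.
  rewrite /dblroot /cub /cub_u /cub_v /= F3 b0 c0 !(mulr0, mul0r, addr0) !eqxx !andbT.
  rewrite exprNn.
  have -> : g d ^+ 3 = d := gK d.
  have -> : g a ^+ 3 = a := gK a.
  by apply/eqP; ring.
exists (c, b); first by rewrite -pair_eqE /= andbC.
apply/and3P; split; apply/eqP.
- transitivity (3 * (b ^+ 2 * c ^+ 2 + 6 * a * b * c * d - a * c ^+ 3
     - b ^+ 3 * d - 9 * a ^+ 2 * d ^+ 2) - bcdisc).
    by rewrite /cub /bcdisc /=; ring.
  by rewrite F3 disc0 mul0r subr0.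
- transitivity (3 * (a * c ^+ 2 + b ^+ 2 * c)); first by rewrite /cub_u /=; ring.
  by rewrite F3 mul0r.
- transitivity (3 * (b * c ^+ 2 + d * b ^+ 2)); first by rewrite /cub_v /=; ring.
  by rewrite F3 mul0r.
Qed.

(** The Hessian [h0 u^2 + h1 u v + h2 v^2] has discriminant [-3 bcdisc], hence is a
    square here, and its zero is the multiple zero of the form.  If the Hessian
    vanishes, the form is the cube of a linear form, up to a constant. *)
Lemma dblroot_ex_charN3 : (3 : F) != 0 -> ~~ cub0 -> bcdisc = 0 ->
  exists2 l, l != 0 & dblroot l.
Proof.
move=> F3 r0 disc0.
have euler l : cub_u l = 0 -> cub_v l = 0 -> dblroot l.
  move=> ru rv; rewrite /dblroot ru rv eqxx !andbT.
  rewrite -(mulrI_eq0 _ (mulfI F3)); apply/eqP.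
  transitivity (l.1 * cub_u l + l.2 * cub_v l); last by rewrite ru rv !mulr0 addr0.
  by rewrite /cub /cub_u /cub_v; ring.
set h0 := b ^+ 2 - 3 * a * c; set h1 := b * c - 9 * a * d.
set h2 := c ^+ 2 - 3 * b * d.
have H : h1 ^+ 2 = 4 * h0 * h2.
  transitivity (4 * h0 * h2 - 3 * bcdisc); last by rewrite disc0 mulr0 subr0.
  by rewrite /h0 /h1 /h2 /bcdisc; ring.
have F4 : (4 : F) != 0 by rewrite (natrM _ 2 2) mulf_neq0.
have [h00|h0n] := eqVneq h0 0; last first.
  exists (- h1, 2 * h0); first by rewrite -pair_eqE /= negb_and mulf_neq0 ?orbT.
  apply: euler.
  - transitivity (3 * a * h1 ^+ 2 - 4 * b * h1 * h0 + 4 * c * h0 ^+ 2).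
      by rewrite /cub_u /=; ring.
    by rewrite H /h0 /h1 /h2; ring.
  - transitivity (b * h1 ^+ 2 - 4 * c * h1 * h0 + 12 * d * h0 ^+ 2).
      by rewrite /cub_v /=; ring.
    by rewrite H /h0 /h1 /h2; ring.
have [h20|h2n] := eqVneq h2 0; last first.
  exists (2 * h2, - h1); first by rewrite -pair_eqE /= negb_and mulf_neq0.
  apply: euler.
  - transitivity (12 * a * h2 ^+ 2 - 4 * b * h1 * h2 + c * h1 ^+ 2).
      by rewrite /cub_u /=; ring.
    by rewrite H /h0 /h1 /h2; ring.
  - transitivity (4 * b * h2 ^+ 2 - 4 * c * h1 * h2 + 3 * d * h1 ^+ 2).
      by rewrite /cub_v /=; ring.
    by rewrite H /h0 /h1 /h2; ring.
have h10 : h1 = 0 by apply/eqP; rewrite -sqrf_eq0 H h00 mulr0 mul0r.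
have [a0|an] := eqVneq a 0; last first.
  exists (- b, 3 * a); first by rewrite -pair_eqE /= negb_and mulf_neq0 ?orbT.
  apply: euler.
  - transitivity (- 3 * a * h0); last by rewrite h00 mulr0.
    by rewrite /cub_u /h0 /=; ring.
  - transitivity (b * h0 - 3 * a * h1); last by rewrite h00 h10 !mulr0 subr0.
    by rewrite /cub_v /h0 /h1 /=; ring.
have [d0|dn] := eqVneq d 0; last first.
  exists (3 * d, - c); first by rewrite -pair_eqE /= negb_and mulf_neq0.
  apply: euler.
  - transitivity (c * h2 - 3 * d * h1); last by rewrite h20 h10 !mulr0 subr0.
    by rewrite /cub_u /h1 /h2 /=; ring.
  - transitivity (- 3 * d * h2); last by rewrite h20 mulr0.
    by rewrite /cub_v /h2 /=; ring.
case/negP: r0; rewrite /cub0 a0 d0 eqxx andbT /=.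
move/eqP: h00; rewrite /h0 a0 mulr0 mul0r subr0 expf_eq0 /= => ->.
by move/eqP: h20; rewrite /h2 d0 mulr0 subr0 expf_eq0.
Qed.

(** The factor [#|F|.-1] counts the representatives of one projective zero, and the
    zero form has [#|F| + 1] projective zeros and discriminant 0. *)
Lemma card_dblroot : #|[set l : F * F | (l != 0) && dblroot l]| =
  (#|F|.-1 * ((bcdisc == 0)%R + #|F| * cub0))%N.
Proof.
have [r0|rn] := boolP cub0.
  have [/eqP a0 /eqP b0 /eqP c0 /eqP d0] := and4P r0.
  have -> : bcdisc = 0.
    by rewrite /bcdisc a0 b0 c0 d0; do !rewrite ?mulr0 ?mul0r ?expr0n ?subr0 ?addr0.
  have -> : [set l : F * F | (l != 0) && dblroot l] = [set~ (0 : F * F)].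
    apply/setP=> l; rewrite !inE /dblroot /cub /cub_u /cub_v a0 b0 c0 d0.
    by do !rewrite ?mulr0 ?mul0r ?addr0 ?eqxx ?andbT.
  rewrite cardsC1 card_prod eqxx muln1.
  have /card_gt0P : exists x : F, x \in predT by exists 0.
  by case: #|_| => // n _; rewrite /=; nia.
rewrite muln0 addn0.
have [disc0|discn] := eqVneq bcdisc 0; last first.
  rewrite muln0; apply/eqP; rewrite cards_eq0 -subset0.
  by apply/subsetP => l; rewrite inE => /andP[l0 /(dblroot_disc l0)/eqP]; rewrite (negPf discn).
have [l0 l0n l0r] : exists2 l, l != 0 & dblroot l.
  by have [F3|F3] := eqVneq (3 : F) 0; [exact: dblroot_ex_char3 | exact: dblroot_ex_charN3].
rewrite muln1; case: l0 => s t in l0n l0r *.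
have -> : [set l : F * F | (l != 0) && dblroot l] =
    [set (k * s, k * t) | k in [set~ (0 : F)]].
  apply/setP=> -[s' t']; rewrite inE; apply/andP/imsetP => [[l'n l'r]|[k]].
    have /eqP : s * t' - t * s' = 0.
      by apply/eqP; apply: contraNT rn => /(dblroot_uniq l0r l'r).
    rewrite subr_eq0 => /eqP E; move: l0n l'n; rewrite -!pair_eqE !negb_and /=.
    have [s0|sn] := eqVneq s 0; rewrite ?orbT /=.
      move=> tn; move: E; rewrite s0 mul0r => /esym/eqP.
      rewrite mulf_eq0 (negPf tn) /= => /eqP->; rewrite eqxx /= => t'n.
      by exists (t' / t); rewrite ?mulr0 ?divfK // !inE mulf_neq0 ?invr_eq0.
    move=> _ l'n; exists (s' / s); last first.
      by rewrite divfK //; congr (_, _); rewrite mulrAC [s' * t]mulrC -E mulrC mulKf.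
    rewrite !inE mulf_neq0 ?invr_eq0 //; apply: contraL l'n => /eqP s'0.
    by move/eqP: E; rewrite s'0 eqxx mulr0 mulf_eq0 (negPf sn) /= => ->.
  rewrite !inE => kn [-> ->]; split; last exact: dblrootZ.
  by move: l0n; rewrite -!pair_eqE /= !mulf_eq0 (negPf kn).
rewrite card_imset ?cardsC1 // => k k' [Es Et].
have [sn|tn] : s != 0 \/ t != 0.
  by apply/orP; rewrite -negb_and; exact: l0n.
- exact: (mulIf sn).
- exact: (mulIf tn).
Qed.

End BinaryCubic.

(** * Determinants and adjugates of three by three matrices *)

Section ThreeByThree.
Variable R : comNzRingType.
Implicit Types (M A B : 'M[R]_3).

Lemma sum_ord3 (f : 'I_3 -> R) : \sum_i f i = f 0 + f 1 + f 2.
Proof.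
rewrite !big_ord_recl big_ord0 addr0 addrA.
by congr (f _ + f _ + f _); apply/val_inj.
Qed.

Lemma det22 (M : 'M[R]_2) : \det M = M 0 0 * M 1 1 - M 0 1 * M 1 0.
Proof.
rewrite (expand_det_row _ 0) !big_ord_recl big_ord0 addr0 /cofactor !det_mx11 !mxE /=.
rewrite expr0 expr1 mul1r mulN1r mulrN.
by congr (M _ _ * M _ _ - M _ _ * M _ _); apply/val_inj.
Qed.

(** With indices modulo 3 the cofactors carry no signs. *)
Lemma adj33 M i j :
  \adj M i j = M (j + 1) (i + 1) * M (j + 2) (i + 2)
             - M (j + 1) (i + 2) * M (j + 2) (i + 1).
Proof.
have E (k : 'I_3) : [\/ k = 0, k = 1 | k = 2].
  by case: k => [[|[|[|]]]] // ?; [constructor 1|constructor 2|constructor 3]; apply/val_inj.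
rewrite mxE /cofactor det22 !mxE.
have l00 : lift (0 : 'I_3) (0 : 'I_2) = 1 by apply/val_inj.
have l01 : lift (0 : 'I_3) (1 : 'I_2) = 2 by apply/val_inj.
have l10 : lift (1 : 'I_3) (0 : 'I_2) = 0 by apply/val_inj.
have l11 : lift (1 : 'I_3) (1 : 'I_2) = 2 by apply/val_inj.
have l20 : lift (2 : 'I_3) (0 : 'I_2) = 0 by apply/val_inj.
have l21 : lift (2 : 'I_3) (1 : 'I_2) = 1 by apply/val_inj.
have a11 : 1 + 1 = 2 :> 'I_3 by apply/val_inj.
have a12 : 1 + 2 = 0 :> 'I_3 by apply/val_inj.
have a21 : 2 + 1 = 0 :> 'I_3 by apply/val_inj.
have a22 : 2 + 2 = 1 :> 'I_3 by apply/val_inj.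
by case: (E i) => ->; case: (E j) => ->;
  rewrite ?l00 ?l01 ?l10 ?l11 ?l20 ?l21 ?add0r ?a11 ?a12 ?a21 ?a22 /=; ring.
Qed.

Lemma det33 M : \det M = M 0 0 * (M 1 1 * M 2 2 - M 1 2 * M 2 1)
  + M 0 1 * (M 1 2 * M 2 0 - M 1 0 * M 2 2)
  + M 0 2 * (M 1 0 * M 2 1 - M 1 1 * M 2 0).
Proof.
rewrite (expand_det_row _ 0) sum_ord3.
have cE j : cofactor M 0 j = \adj M j 0 by rewrite mxE.
rewrite !cE !adj33 !add0r.
have a11 : 1 + 1 = 2 :> 'I_3 by apply/val_inj.
have a12 : 1 + 2 = 0 :> 'I_3 by apply/val_inj.
have a21 : 2 + 1 = 0 :> 'I_3 by apply/val_inj.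
have a22 : 2 + 2 = 1 :> 'I_3 by apply/val_inj.
by rewrite a11 a12 a21 a22.
Qed.

Lemma tr_adj33 A B : \tr (\adj A *m B) =
  B 0 0 * (A 1 1 * A 2 2 - A 1 2 * A 2 1) + B 0 1 * (A 1 2 * A 2 0 - A 1 0 * A 2 2)
  + B 0 2 * (A 1 0 * A 2 1 - A 1 1 * A 2 0)
  + B 1 0 * (A 2 1 * A 0 2 - A 2 2 * A 0 1) + B 1 1 * (A 2 2 * A 0 0 - A 2 0 * A 0 2)
  + B 1 2 * (A 2 0 * A 0 1 - A 2 1 * A 0 0)
  + B 2 0 * (A 0 1 * A 1 2 - A 0 2 * A 1 1) + B 2 1 * (A 0 2 * A 1 0 - A 0 0 * A 1 2)
  + B 2 2 * (A 0 0 * A 1 1 - A 0 1 * A 1 0).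
Proof.
have a11 : 1 + 1 = 2 :> 'I_3 by apply/val_inj.
have a12 : 1 + 2 = 0 :> 'I_3 by apply/val_inj.
have a21 : 2 + 1 = 0 :> 'I_3 by apply/val_inj.
have a22 : 2 + 2 = 1 :> 'I_3 by apply/val_inj.
have E M : \tr M = M 0 0 + M 1 1 + M 2 2 by exact: sum_ord3.
have E2 M N i j : (M *m N) i j = M i 0 * N 0 j + M i 1 * N 1 j + M i 2 * N 2 j.
  by rewrite mxE sum_ord3.
by rewrite E !E2 !adj33 !add0r a11 a12 a21 a22; ring.
Qed.

Lemma det_pencil A B s t : \det (s *: A + t *: B) =
  \det A * s ^+ 3 + \tr (\adj A *m B) * s ^+ 2 * t
  + \tr (\adj B *m A) * s * t ^+ 2 + \det B * t ^+ 3.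
Proof. by rewrite !tr_adj33 !det33 !mxE; ring. Qed.

(** The partial derivative of [det_pencil] with respect to [s]. *)
Lemma tr_adj_pencil A B s t : \tr (\adj (s *: A + t *: B) *m A) =
  3 * \det A * s ^+ 2 + 2 * \tr (\adj A *m B) * s * t
  + \tr (\adj B *m A) * t ^+ 2.
Proof. by rewrite !tr_adj33 !det33 !mxE; ring. Qed.

End ThreeByThree.

Section Rank.
Variable F : fieldType.
Implicit Types P : 'M[F]_3.

Lemma adj_rank1 P : (\rank P <= 1)%N -> \adj P = 0.
Proof.
move=> rP; have [u [v ->]] : exists u : 'cV_3, exists v : 'rV_3, P = u *m v.
  have [->|Pn] := eqVneq P 0; first by exists 0, 0; rewrite mulmx0.
  have [v vP vn] := rowV0Pn Pn.
  have /submxP[u ->] : (P <= v)%MS.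
    by rewrite -(geq_leqif (mxrank_leqif_sup vP)) rank_rV vn.
  by exists u, v.
apply/matrixP=> i j; rewrite adj33 !mxE !big_ord_recl !big_ord0 !addr0.
by ring.
Qed.

(** All two by two minors vanish, so any row with a nonzero entry spans the others. *)
Lemma rank_adj0 P : \adj P = 0 -> (\rank P <= 1)%N.
Proof.
move=> adj0; have E i j : P (j + 1) (i + 1) * P (j + 2) (i + 2) =
    P (j + 1) (i + 2) * P (j + 2) (i + 1).
  by apply/eqP; rewrite -subr_eq0 -adj33 adj0 mxE.
have c1 (i : 'I_3) : i + 2 + 1 = i by case: i => [[|[|[|]]]] // ?; apply/val_inj.
have c2 (i : 'I_3) : i + 2 + 2 = i + 1 by case: i => [[|[|[|]]]] // ?; apply/val_inj.
have c3 (i : 'I_3) : i + 1 + 1 = i + 2 by case: i => [[|[|[|]]]] // ?; apply/val_inj.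
have c4 (i : 'I_3) : i + 1 + 2 = i by case: i => [[|[|[|]]]] // ?; apply/val_inj.
have sp (i k : 'I_3) : [\/ k = i, k = i + 1 | k = i + 2].
  by case: i => [[|[|[|]]]] // ?; case: k => [[|[|[|]]]] // ?;
    do [by constructor 1; apply/val_inj | by constructor 2; apply/val_inj
       | by constructor 3; apply/val_inj].
have m1 i j l : P i j * P (i + 1) l = P i l * P (i + 1) j.
  case: (sp j l) => ->; first by rewrite mulrC.
    by have := E (j + 2) (i + 2); rewrite !c1 !c2.
  by have := E (j + 1) (i + 2); rewrite !c1 !c2 c3 c4 => ->.
have m2 i j k l : P i j * P k l = P i l * P k j.
  case: (sp i k) => ->; [by rewrite mulrC | exact: m1 | ].
  by have := m1 (i + 2) j l; rewrite c1 => E'; rewrite mulrC -E' mulrC.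
have [->|/matrix0Pn[i [j Pij]]] := eqVneq P 0; first by rewrite mxrank0.
apply: leq_trans (_ : (\rank (row i P) <= 1)%N); last exact: rank_leq_row.
apply/mxrankS/row_subP => k; apply/sub_rVP; exists (P k j / P i j).
by apply/rowP => l; rewrite !mxE -[LHS](mulfK Pij) mulrC [P k l * _]mulrC m2; ring.
Qed.

(** The rows of [\adj P] lie in the kernel of [P], which [e] spans, and symmetry
    makes the column factor proportional to [e^T] as well. *)
Lemma adj_rank2 P (e : 'rV[F]_3) : P^T = P -> \rank P = 2%N -> e != 0 -> e *m P = 0 ->
  exists2 c, c != 0 & \adj P = c *: (e^T *m e).
Proof.
move=> Psym rP en eP.
have detP : \det P = 0.
  apply/eqP; rewrite -[_ == 0]negbK -unitfE -unitmxE -row_free_unit.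
  by rewrite /row_free rP.
have /submxP[D adjE] : (\adj P <= e)%MS.
  have e_ker : (e <= kermx P)%MS by apply/sub_kermxP.
  apply: submx_trans (_ : (kermx P <= e)%MS).
    by apply/sub_kermxP; rewrite mul_adj_mx detP raddf0.
  by rewrite -(geq_leqif (mxrank_leqif_sup e_ker)) mxrank_ker rP rank_rV en.
have /rV0Pn[j ej] := en.
have DE : D = (D j 0 / e 0 j) *: e^T.
  have S : (\adj P)^T = \adj P by rewrite trmx_adj Psym.
  apply/colP=> i; rewrite !mxE; apply: (mulIf ej); rewrite mulrAC divfK //.
  have /matrixP/(_ i j) := S; rewrite adjE !mxE !big_ord_recl !big_ord0 !addr0.
  by rewrite mulrC => <-; rewrite mulrC.
exists (D j 0 / e 0 j); last by rewrite adjE {1}DE scalemxAl.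
apply/eqP=> c0; have : (\rank P <= 1)%N.
  by apply: rank_adj0; rewrite adjE DE c0 scale0r mul0mx.
by rewrite rP.
Qed.

End Rank.

(** * Orthogonality and forms vanishing on a hyperplane *)

Section Orthogonality.
Variable F : fieldType.

Lemma sub_orthP n m k (u : 'M[F]_(m, n)) (f : 'M[F]_(k, n)) :
  reflect (forall v : 'rV_n, v *m f^T = 0 -> v *m u^T = 0) (u <= f)%MS.
Proof.
apply: (iffP submxP) => [[D ->] v vf0|h].
  by rewrite trmx_mul mulmxA vf0 mul0mx.
apply/submxP; rewrite submxE; apply/eqP; apply: trmx_inj; rewrite trmx0.
rewrite trmx_mul; apply/row_matrixP => i; rewrite row_mul row0; apply: h.
by rewrite -row_mul -trmx_mul mulmx_coker trmx0 row0.
Qed.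

Lemma ker_neq0 n m (M : 'M[F]_(n, m)) : (\rank M < n)%N ->
  exists2 e : 'rV_n, e != 0 & e *m M = 0.
Proof.
move=> ltr; have : kermx M != 0 by rewrite -mxrank_eq0 mxrank_ker subn_eq0 -ltnNge.
by case/rowV0Pn => e /sub_kermxP eM en; exists e.
Qed.

Lemma ker_rank n m (M : 'M[F]_(n, m)) (e : 'rV_n) :
  e != 0 -> e *m M = 0 -> (\rank M < n)%N.
Proof.
move=> en eM; have := rank_leq_row M; rewrite leq_eqVlt => /orP[|//] fr.
by case/negP: en; apply/eqP; apply: (row_free_inj fr); rewrite eM mul0mx.
Qed.

Lemma det_rank n (M : 'M[F]_n) : (\det M == 0) = (\rank M < n)%N.
Proof.
rewrite -[_ == 0]negbK -unitfE -unitmxE -row_free_unit /row_free.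
by rewrite ltn_neqAle rank_leq_row andbT.
Qed.

Lemma sub_rank_swap n m k (A : 'M[F]_(m, n)) (B : 'M[F]_(k, n)) :
  (A <= B)%MS -> (\rank B <= \rank A)%N -> (B <= A)%MS.
Proof. by move=> sAB; rewrite (geq_leqif (mxrank_leqif_sup sAB)). Qed.

Lemma tr_mx11 (M : 'M[F]_1) : M^T = M.
Proof. by apply/matrixP => i j; rewrite !ord1 mxE. Qed.

Lemma sym_form n (A : 'M[F]_n) (v w : 'rV_n) : A^T = A ->
  v *m A *m w^T = w *m A *m v^T.
Proof. by move=> As; rewrite -[LHS]tr_mx11 !trmx_mul trmxK As mulmxA. Qed.

Lemma sym_ker n (A : 'M[F]_n) (e : 'rV_n) : A^T = A ->
  (A *m e^T == 0) = (e *m A == 0).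
Proof. by move=> As; rewrite -trmx_eq0 trmx_mul trmxK As. Qed.

End Orthogonality.

Section Vanishing.
Variable F : finFieldType.
Hypothesis F2 : (2 : F) != 0.

Definition isotropic n (A : 'M[F]_n) (v : 'rV_n) := v *m A *m v^T == 0.

Definition vanishing n (f : 'rV[F]_n) (A : 'M[F]_n) :=
  [forall v : 'rV_n, (v *m f^T == 0) ==> isotropic A v].

Lemma vanishing_polar n (f : 'rV[F]_n) A (v w : 'rV_n) : A^T = A -> vanishing f A ->
  v *m f^T = 0 -> w *m f^T = 0 -> v *m A *m w^T = 0.
Proof.
move=> As /forall_inP fA vf wf; have h (u : 'rV_n) : u *m f^T = 0 -> u *m A *m u^T = 0.
  by move=> uf; apply/eqP/fA/eqP.
have := h (v + w); rewrite mulmxDl vf wf addr0 => /(_ erefl).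
rewrite [(v + w)^T]linearD /= !mulmxDl !mulmxDr (h v) // (h w) // addr0 add0r.
rewrite (sym_form w v As) -mulr2n -scaler_nat => /eqP.
by rewrite scaler_eq0 (negPf F2) => /eqP.
Qed.

(** By polarisation [e *m A] is orthogonal to the hyperplane [f], of which [e] is a
    point. *)
Lemma vanishing_sub n (f : 'rV[F]_n) A (e : 'rV_n) : A^T = A -> vanishing f A ->
  e *m f^T = 0 -> (e *m A <= f)%MS.
Proof.
move=> As fA ef; apply/sub_orthP => v vf.
by rewrite trmx_mul As mulmxA (vanishing_polar As fA).
Qed.

(** The form maps the hyperplane into the line of [f]; were it nondegenerate, the
    hyperplane would have dimension at most 1. *)
Lemma vanishing_rank n (f : 'rV[F]_n.+3) A : A^T = A -> vanishing f A ->
  (\rank A < n.+3)%N.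
Proof.
move=> As fA; rewrite ltnNge; apply/negP => rA.
have frA : row_free A by rewrite /row_free eqn_leq rank_leq_row.
have : (kermx f^T *m A <= f)%MS.
  apply/row_subP => i; rewrite row_mul; apply: vanishing_sub => //.
  by rewrite -row_mul mulmx_ker row0.
move/mxrankS; rewrite mxrankMfree // mxrank_ker mxrank_tr => h.
have := leq_trans h (rank_leq_row f); have := rank_leq_row f.
by case: (\rank f) => [|[|]].
Qed.

Lemma vanishing_pencil n (f : 'rV[F]_n) A B s t :
  vanishing f A -> vanishing f B -> vanishing f (s *: A + t *: B).
Proof.
move=> /forall_inP fA /forall_inP fB; apply/forall_inP => v vf.
rewrite /isotropic mulmxDr mulmxDl -!scalemxAr -!scalemxAl.
by rewrite (eqP (fA v vf)) (eqP (fB v vf)) !scaler0 addr0.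
Qed.

(** The hyperplane and [e] together span the whole space. *)
Lemma vanishing_ker_off n (f : 'rV[F]_n) A (e : 'rV_n) : A^T = A -> vanishing f A ->
  e *m A = 0 -> e *m f^T != 0 -> A = 0.
Proof.
move=> As fA eA ef.
have [c cE] : exists c, e *m f^T = c%:M by exists ((e *m f^T) 0 0); exact: mx11_scalar.
have cn : c != 0 by apply: contra ef => /eqP c0; rewrite cE c0 raddf0.
have sp (v : 'rV_n) : exists2 v0, v0 *m f^T = 0 & v0 *m A = v *m A.
  have [d dE] : exists d, v *m f^T = d%:M by exists ((v *m f^T) 0 0); exact: mx11_scalar.
  exists (v - (d / c) *: e).
    by rewrite mulmxBl -scalemxAl cE dE scale_scalar_mx divfK // subrr.
  by rewrite mulmxBl -scalemxAl eA scaler0 subr0.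
apply/row_matrixP => i; rewrite row0 rowE.
have [v0 v0f <-] := sp (delta_mx 0 i).
apply/eqP; rewrite -sym_ker //; apply/eqP/row_matrixP => j; rewrite row0 row_mul rowE.
have [w0 w0f <-] := sp (delta_mx 0 j).
exact: vanishing_polar fA w0f v0f.
Qed.

(** A common point [e] of two distinct hyperplanes has [e *m A] proportional to both
    [f] and [f'], hence is in the kernel of [A], and likewise of [B]. *)
Lemma vanishing_uniq n (f f' : 'rV[F]_n.+3) A B : A^T = A -> B^T = B ->
  f != 0 -> f' != 0 ->
  vanishing f A -> vanishing f B -> vanishing f' A -> vanishing f' B ->
  (forall e : 'rV_n.+3, e *m A = 0 -> e *m B = 0 -> e = 0) -> (f' <= f)%MS.
Proof.
move=> As Bs fn f'n fA fB f'A f'B noker; apply: contraT => nsub.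
have [|e en] := @ker_neq0 _ _ _ (row_mx f^T f'^T).
  by apply: leq_ltn_trans (rank_leq_col _) _.
rewrite mul_mx_row => /eqP; rewrite row_mx_eq0 => /andP[/eqP ef /eqP ef'].
have ker M : M^T = M -> vanishing f M -> vanishing f' M -> e *m M = 0.
  move=> Ms fM f'M; have /sub_rVP[c cE] := vanishing_sub Ms fM ef.
  have /sub_rVP[c' c'E] := vanishing_sub Ms f'M ef'.
  have [c'0|c'n] := eqVneq c' 0; first by rewrite c'E c'0 scale0r.
  case/negP: nsub; apply/sub_rVP; exists (c / c').
  by rewrite mulrC -scalerA -cE c'E scalerK.
by case/eqP: en; apply: noker; apply: ker.
Qed.

End Vanishing.

(** * Multiple zeros of the determinant of a pencil, by linear conditions *)

Section Counting.
Variable F : finFieldType.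
Notation q := #|F|.

Lemma sum_bool (T : finType) (P Q : pred T) :
  \sum_(x | P x) (Q x : nat) = #|[set x | P x && Q x]|.
Proof.
rewrite -sum1_card big_mkcond [RHS]big_mkcond /=; apply: eq_bigr => x _.
by rewrite inE; case: (P x); case: (Q x).
Qed.

Lemma card_span m n (G : 'M[F]_(m, n)) :
  #|[set v : 'rV_n | (v != 0) && (v <= G)%MS]| = (q ^ \rank G).-1.
Proof.
rewrite -card_rowg [in RHS](cardsD1 (0 : 'rV_n)) inE sub0mx add1n /=.
by apply: eq_card => v; rewrite !inE.
Qed.

Lemma card_span1 m n (G : 'M[F]_(m, n)) : \rank G = 1%N ->
  #|[set v : 'rV_n | (v != 0) && (v <= G)%MS]| = q.-1.
Proof. by move=> rG; rewrite card_span rG expn1. Qed.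

Lemma card_orth n (e : 'rV[F]_n) : e != 0 ->
  #|[set f : 'rV_n | (f != 0) && (f *m e^T == 0)]| = (q ^ n.-1).-1.
Proof.
move=> en; have <- : \rank (kermx e^T) = n.-1.
  by rewrite mxrank_ker mxrank_tr rank_rV en subn1.
rewrite -card_span.
by apply: eq_card => f; rewrite !inE; congr (_ && _); apply/eqP/sub_kermxP.
Qed.

Lemma q_gt0 : (0 < q)%N. Proof. by apply/card_gt0P; exists 0. Qed.

Lemma predX2 : (q ^ 2).-1 = (q.-1 * q + q.-1)%N.
Proof. by case: #|_| q_gt0 => // m _; rewrite -mulnn /=; lia. Qed.

Lemma predX3 : (q ^ 3).-1 = (q.-1 * (q ^ 2 + q) + q.-1)%N.
Proof.
by case: #|_| q_gt0 => // m _; rewrite expnS -mulnn /=; lia.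
Qed.

Section FlagCount.
Variables (P : 'M[F]_3).
Hypothesis Ps : P^T = P.

Lemma rank3_cases : [\/ P = 0, \rank P = 1%N, \rank P = 2%N | \rank P = 3%N].
Proof.
have := rank_leq_row P; have := mxrank_eq0 P.
case: (\rank P) => [|[|[|[|]]]] // E _; last by constructor 4.
- by constructor 1; apply/eqP; rewrite -E.
- by constructor 2.
- by constructor 3.
Qed.

Lemma card_sup_rank2 (f : 'rV[F]_3) : (1 < \rank P)%N -> (P <= f)%MS = false.
Proof.
by move=> rP; apply/negP => /mxrankS h; have := leq_trans rP (leq_trans h (rank_leq_row f)).
Qed.

Lemma sup_rank1 (f : 'rV[F]_3) : \rank P = 1%N -> f != 0 -> (P <= f)%MS = (f <= P)%MS.
Proof.
move=> rP fn; apply/idP/idP => /sub_rank_swap -> //; by rewrite rank_rV fn rP.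
Qed.

(** The weight of a vector [e] in [dbl_pencil_indicator]: all contributions cancel unless
    [e] is the vertex of a form of rank exactly 2.  For rank 1 the only line is
    the double line [P] itself, and for rank 0 all [q + 1] lines through [e] count. *)
Lemma flag_count (e : 'rV[F]_3) : e != 0 ->
  (q.-1 * (e *m P == 0)%R + q.-1 * q * (P == 0)%R =
   \sum_(f : 'rV[F]_3 | ((f != 0) && (f *m e^T == 0))%R) ((P <= f)%MS : nat)
   + q.-1 * ((e *m P == 0)%R && (\rank P == 2)))%N.
Proof.
move=> en; have q0 := q_gt0; case: rank3_cases => rP.
- rewrite rP mulmx0 mxrank0 !eqxx !muln1 muln0 addn0.
  rewrite (eq_bigr (fun=> 1%N)) => [|f _]; last by rewrite sub0mx.
  by rewrite sum1dep_card card_orth //= predX2 addnC.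
- have Pn : P != 0 by rewrite -mxrank_eq0 rP.
  rewrite (negPf Pn) rP andbF !muln0 !addn0 sum_bool.
  have [eP|eP] := eqVneq (e *m P) 0; last first.
    rewrite muln0; apply/esym/eqP; rewrite cards_eq0 -subset0; apply/subsetP => f.
    rewrite inE => /andP[/andP[fn /eqP fe] Pf]; case/negP: eP.
    rewrite -sym_ker //; move/submxP: Pf => [D PE].
    by rewrite PE -mulmxA fe mulmx0.
  rewrite muln1 -(card_span1 rP); apply: eq_card => f; rewrite !inE.
  have [//|fn] := eqVneq f 0; rewrite sup_rank1 //= andb_idl // => /submxP[D ->].
  by rewrite -mulmxA; move/eqP: eP; rewrite -sym_ker // => /eqP->; rewrite mulmx0.
- have Pn : P != 0 by rewrite -mxrank_eq0 rP.
  rewrite (negPf Pn) rP andbT muln0 addn0 big1 // => f _.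
  by rewrite card_sup_rank2 ?rP.
- have Pn : P != 0 by rewrite -mxrank_eq0 rP.
  rewrite (negPf Pn) rP andbF !muln0 !addn0 big1 => [|f _]; last first.
    by rewrite card_sup_rank2 ?rP.
  by have [/(ker_rank en)|] := eqVneq; rewrite ?rP ?muln0.
Qed.

Lemma base_count : \sum_(f : 'rV[F]_3 | (f != 0)%R) ((P <= f)%MS : nat) =
  (q.-1 * (\rank P <= 1) + q.-1 * (q ^ 2 + q) * (P == 0)%R)%N.
Proof.
have q0 := q_gt0; rewrite sum_bool; case: rank3_cases => rP.
- rewrite rP mxrank0 eqxx !muln1.
  transitivity #|[set~ 0 : 'rV[F]_3]|.
    by apply: eq_card => f; rewrite !inE sub0mx andbT.
  by rewrite cardsC1 card_mx mul1n predX3 addnC.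
- have Pn : P != 0 by rewrite -mxrank_eq0 rP.
  rewrite (negPf Pn) rP !muln0 addn0 muln1 -(card_span1 rP).
  apply: eq_card => f; rewrite !inE.
  by have [//|fn] := eqVneq f 0; rewrite sup_rank1.
- rewrite rP -mxrank_eq0 rP !muln0; apply/eqP; rewrite cards_eq0 -subset0.
  by apply/subsetP => f; rewrite inE card_sup_rank2 ?rP ?andbF.
- rewrite rP -mxrank_eq0 rP !muln0; apply/eqP; rewrite cards_eq0 -subset0.
  by apply/subsetP => f; rewrite inE card_sup_rank2 ?rP ?andbF.
Qed.

(** For [P = s A + t B] these are the determinant of the pencil and its two partial
    derivatives at [(s, t)]. *)
Definition dbl_pencil (A B : 'M[F]_3) :=
  [&& \det P == 0, \tr (\adj P *m A) == 0 & \tr (\adj P *m B) == 0].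

Lemma dbl_pencil_rank1 A B : (\rank P <= 1)%N -> dbl_pencil A B.
Proof.
move=> rP; rewrite /dbl_pencil det_rank (leq_ltn_trans rP) //=.
by rewrite adj_rank1 // !mul0mx mxtrace0 eqxx.
Qed.

(** The adjugate is a nonzero multiple of [e^T *m e], so [\tr (\adj P *m M)] is one
    of the value of [M] at [e]. *)
Lemma dbl_pencil_rank2 A B (e : 'rV[F]_3) : \rank P = 2%N -> e != 0 -> e *m P = 0 ->
  dbl_pencil A B = isotropic A e && isotropic B e.
Proof.
move=> rP en eP; have [c cn adjE] := adj_rank2 Ps rP en eP.
have trE M : (\tr (\adj P *m M) == 0) = isotropic M e.
  rewrite adjE -scalemxAl mxtraceZ mulf_eq0 (negPf cn) /=.
  rewrite -mulmxA mxtrace_mulC trace_mx11 /isotropic.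
  apply/eqP/eqP => [h|->]; last by rewrite mxE.
  by rewrite [LHS]mx11_scalar h raddf0.
by rewrite /dbl_pencil !trE det_rank rP.
Qed.

Lemma dbl_pencil_count A B :
  (q.-1 * dbl_pencil A B = q.-1 * (\rank P <= 1) +
   \sum_(e : 'rV[F]_3 | (e != 0)%R)
     [&& (e *m P == 0)%R, \rank P == 2, isotropic A e & isotropic B e])%N.
Proof.
rewrite sum_bool; have [rP|rP] := leqP (\rank P) 1.
  rewrite dbl_pencil_rank1 // -[LHS]addn0; congr (_ + _)%N.
  apply/esym/eqP; rewrite cards_eq0 -subset0; apply/subsetP => e.
  by rewrite inE => /and4P[_ _ /eqP r2 _]; rewrite r2 in rP.
rewrite muln0 add0n; have [rP2|rPn] := eqVneq (\rank P) 2%N; last first.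
  have rP3 : \rank P = 3%N.
    by have := rank_leq_row P; case: (\rank P) rP rPn => [|[|[|[|]]]].
  rewrite /dbl_pencil det_rank rP3 muln0.
  by apply/esym/eqP; rewrite cards_eq0 -subset0; apply/subsetP => e; rewrite inE !andbF.
transitivity (#|[set e : 'rV[F]_3 | (e != 0)%R && (e <= kermx P)%MS]| * dbl_pencil A B)%N.
  by rewrite card_span mxrank_ker rP2 expn1.
have E (e : 'rV[F]_3) : e != 0 -> (e <= kermx P)%MS ->
    dbl_pencil A B = isotropic A e && isotropic B e.
  by move=> en /sub_kermxP; exact: dbl_pencil_rank2.
have Ek (e : 'rV[F]_3) : (e <= kermx P)%MS = (e *m P == 0) by apply/sub_kermxP/eqP.
case D: (dbl_pencil A B) E => E; rewrite ?muln1 ?muln0.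
  apply: eq_card => e; rewrite !inE -Ek /=; case: (eqVneq e 0) => //= en.
  by case K : (_ <= _)%MS => //=; rewrite -E.
apply/esym/eqP; rewrite cards_eq0 -subset0; apply/subsetP => e.
by rewrite !inE -Ek /=; case: (eqVneq e 0) => //= en; case K : (_ <= _)%MS => //=; rewrite -E.
Qed.

(** Sum [flag_count] over the common zeros [e] of [A] and [B] to isolate rank 2, and use
    [base_count] for rank at most 1. *)
Lemma dbl_pencil_indicator A B :
  (q.-1 ^ 2 * dbl_pencil A B
   + \sum_(e : 'rV[F]_3 | (e != 0)%R) \sum_(f : 'rV[F]_3 | ((f != 0) && (f *m e^T == 0))%R)
       [&& (P <= f)%MS, isotropic A e & isotropic B e]
   + q.-1 ^ 2 * (q ^ 2 + q) * (P == 0)%R =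
   q.-1 * (\sum_(e : 'rV[F]_3 | (e != 0)%R)
             [&& (e *m P == 0)%R, isotropic A e & isotropic B e])
   + q.-1 * (\sum_(f : 'rV[F]_3 | (f != 0)%R) ((P <= f)%MS : nat))
   + q.-1 * q * (\sum_(e : 'rV[F]_3 | (e != 0)%R)
                  [&& (P == 0)%R, isotropic A e & isotropic B e]))%N.
Proof.
have F1 :
  (q.-1 * (\sum_(e : 'rV[F]_3 | (e != 0)%R)
     [&& (e *m P == 0)%R, isotropic A e & isotropic B e])
   + q.-1 * q * (\sum_(e : 'rV[F]_3 | (e != 0)%R)
     [&& (P == 0)%R, isotropic A e & isotropic B e]) =
   \sum_(e : 'rV[F]_3 | (e != 0)%R) \sum_(f : 'rV[F]_3 | ((f != 0) && (f *m e^T == 0))%R)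
       [&& (P <= f)%MS, isotropic A e & isotropic B e]
   + q.-1 * \sum_(e : 'rV[F]_3 | (e != 0)%R)
     [&& (e *m P == 0)%R, \rank P == 2, isotropic A e & isotropic B e])%N.
  rewrite !big_distrr -!big_split /=; apply: eq_bigr => e en.
  have := flag_count en; case: (isotropic A e && isotropic B e) => h.
    rewrite !andbT h; congr (_ + _)%N.
    by apply: eq_bigr => f _; rewrite andbT.
  by rewrite !andbF !muln0 big1 // => f _; rewrite andbF.
have F2 := base_count; have F3 := dbl_pencil_count A B.
move: F1 F2 F3.
set n1 := (\sum_(e | _) [&& (e *m P == 0)%R, isotropic A e & isotropic B e])%N.
set n2 := (\sum_(f : 'rV[F]_3 | _) ((P <= f)%MS : nat))%N.
set n3 := (\sum_(e | _) \sum_(f | _) _)%N.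
set n4 := (\sum_(e | _) [&& (e *m P == 0)%R, \rank P == 2, isotropic A e & isotropic B e])%N.
set n5 := (\sum_(e : 'rV[F]_3 | _) [&& (P == 0)%R, isotropic A e & isotropic B e])%N.
move=> F1 F2 F3; rewrite expnS expn1 -mulnA F3 F2; nia.
Qed.

End FlagCount.
End Counting.

(** * Pencils of singular conics, by linear conditions *)

Section ZeroResolvent.
Variable F : finFieldType.
Hypothesis F2 : (2 : F) != 0.
Notation q := #|F|.

(** The Gram determinant of [v], [w], [e] is [- R(v) * R(e, w) ^+ 2], and it vanishes
    together with [\det R]. *)
Lemma gram_isotropic (R : 'M[F]_3) (e v w : 'rV_3) : R^T = R -> \det R = 0 ->
  isotropic R e -> v *m R *m e^T = 0 -> e *m R *m w^T != 0 -> isotropic R v.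
Proof.
move=> Rs detR /eqP eRe vRe eRw.
pose U : 'M[F]_3 := \matrix_i nth 0 [:: v; w; e] i.
have : \det (U *m R *m U^T) = 0 by rewrite !det_mulmx detR mulr0 mul0r.
have gE i j : (U *m R *m U^T) i j =
    (nth 0 [:: v; w; e] i *m R *m (nth 0 [:: v; w; e] j)^T) 0 0.
  have rE k : row k U = nth 0 [:: v; w; e] k by rewrite rowK.
  rewrite -!rE -row_mul tr_row [LHS]mxE [RHS]mxE; apply: eq_bigr => k _.
  by rewrite [row _ _ _ _]mxE [col _ _ _ _]mxE.
have eRv : e *m R *m v^T = 0 by rewrite sym_form.
have wRe : w *m R *m e^T = e *m R *m w^T by rewrite sym_form.
have z0 : (0 : 'M[F]_1) 0 0 = 0 by rewrite mxE.
rewrite det33 !gE /= vRe eRv eRe wRe z0 => /eqP.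
rewrite !(mul0r, mulr0, oppr0, subr0, sub0r, addr0, add0r).
rewrite mulrN oppr_eq0 !mulf_eq0 orbb => /orP[] /eqP z.
  by rewrite /isotropic [_ *m _ *m _]mx11_scalar z raddf0.
by case/eqP: eRw; rewrite [LHS]mx11_scalar z raddf0.
Qed.

(** Both [Q] and [P + Q] satisfy [gram_isotropic] at the points of the line
    [e *m Q], the tangent line at [e] of the pencil. *)
Lemma component_of_ker (P Q : 'M[F]_3) (e : 'rV_3) : P^T = P -> Q^T = Q ->
  e *m P = 0 -> e *m Q != 0 -> isotropic Q e -> \det Q = 0 -> \det (P + Q) = 0 ->
  vanishing (e *m Q) P && vanishing (e *m Q) Q.
Proof.
move=> Ps Qs eP eQn eQe dQ dPQ; have [j eQj] := rV0Pn _ eQn.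
pose w : 'rV[F]_3 := delta_mx 0 j.
have eQw : e *m Q *m w^T != 0.
  apply: contraNneq eQj => /matrixP/(_ 0 0).
  by rewrite trmx_delta -colE !mxE => ->.
have isoQ v : v *m (e *m Q)^T = 0 -> isotropic Q v.
  rewrite trmx_mul Qs mulmxA => vQe.
  exact: gram_isotropic dQ eQe vQe eQw.
have vP (v : 'rV_3) : v *m P *m e^T = 0 by rewrite sym_form // eP mul0mx.
apply/andP; split; apply/forall_inP => v /eqP vf; last exact: isoQ.
have : isotropic (P + Q) v.
  apply: (@gram_isotropic (P + Q) e v w) => //.
  - by rewrite linearD /= Ps Qs.
  - by rewrite /isotropic mulmxDr eP add0r.
  - by rewrite mulmxDr mulmxDl vP add0r -vf trmx_mul Qs mulmxA.
  - by rewrite mulmxDr eP add0r.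
by rewrite /isotropic mulmxDr mulmxDl (eqP (isoQ v vf)) addr0.
Qed.

Variables (A B : 'M[F]_3).
Hypotheses (As : A^T = A) (Bs : B^T = B).

Definition zero_pencil :=
  cub0 (\det A) (\tr (\adj A *m B)) (\tr (\adj B *m A)) (\det B).

(** Over the field with 3 elements too, the four values at [(1, 0)], [(0, 1)],
    [(1, 1)] and [(1, -1)] determine a cubic form. *)
Lemma zero_pencilP : (forall s t, \det (s *: A + t *: B) = 0) <-> zero_pencil.
Proof.
split=> [h|/and4P[/eqP a0 /eqP b0 /eqP c0 /eqP d0] s t]; last first.
  by rewrite det_pencil a0 b0 c0 d0 !mul0r !addr0.
have a0 : \det A = 0 by have := h 1 0; rewrite scale1r scale0r addr0.
have d0 : \det B = 0 by have := h 0 1; rewrite scale1r scale0r add0r.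
have e1 := h 1 1; have e2 := h 1 (-1); rewrite !det_pencil a0 d0 in e1 e2.
rewrite /zero_pencil /cub0 a0 d0 eqxx /=; move: e1 e2.
set b := \tr _; set c := \tr _ => e1 e2.
have bc : b + c = 0 by rewrite -[RHS]e1; ring.
have cb : c - b = 0 by rewrite -[RHS]e2; ring.
have c0 : c = 0.
  by apply: (mulfI F2); transitivity (b + c + (c - b)); [ring | rewrite bc cb addr0 mulr0].
by move: bc; rewrite c0 addr0 => ->; rewrite eqxx.
Qed.

(** If both ranks are at most 1, the kernels meet.  Otherwise one form has rank 2, its
    vertex [e] lies on the other conic because the determinant of the pencil has no
    mixed term, and [component_of_ker] applies. *)
Lemma component_exists : zero_pencil ->
  (forall e : 'rV_3, e *m A = 0 -> e *m B = 0 -> e = 0) ->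
  exists2 f : 'rV_3, f != 0 & vanishing f A && vanishing f B.
Proof.
move=> zp noker; have det0 := iffRL zero_pencilP zp.
have [/eqP dA /eqP bAB /eqP bBA /eqP dB] := and4P zp.
have dAB : \det (A + B) = 0 by have := det0 1 1; rewrite !scale1r.
have step (P Q : 'M[F]_3) : P^T = P -> Q^T = Q -> \det Q = 0 -> \det (P + Q) = 0 ->
    \tr (\adj P *m Q) = 0 -> \rank P = 2%N ->
    (forall e : 'rV_3, e *m P = 0 -> e *m Q = 0 -> e = 0) ->
    exists2 f : 'rV_3, f != 0 & vanishing f P && vanishing f Q.
  move=> Ps Qs dQ dPQ tr0 rP nokerPQ.
  have [|e en eP] := @ker_neq0 _ _ _ P; first by rewrite rP.
  have eQ : e *m Q != 0 by apply: contraNneq en => eQ; apply/eqP/nokerPQ.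
  have dP : \det P = 0 by apply/eqP; rewrite det_rank rP.
  exists (e *m Q) => //; apply: component_of_ker => //.
  have := dbl_pencil_rank2 Ps P Q rP en eP.
  rewrite /dbl_pencil dP tr0 mul_adj_mx dP raddf0 mxtrace0 eqxx /=.
  by case/esym/andP.
have rk2 (M : 'M[F]_3) : \det M = 0 -> (1 < \rank M)%N -> \rank M = 2%N.
  by move/eqP; rewrite det_rank => r3 r1; apply/eqP; rewrite eqn_leq r1 -ltnS r3.
have [rA|rA] := ltnP 1 (\rank A); first exact: step As Bs dB dAB bAB (rk2 _ dA rA) noker.
have [rB|rB] := ltnP 1 (\rank B).
  have [||f fn] := step _ _ Bs As dA _ bBA (rk2 _ dB rB); first by rewrite addrC.
    by move=> e eB eA; apply: noker.
  by rewrite andbC; exists f.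
have : (kermx A :&: kermx B)%MS != 0.
  rewrite -mxrank_eq0 -lt0n; have := mxrank_sum_cap (kermx A) (kermx B).
  rewrite !mxrank_ker; have := rank_leq_col (kermx A + kermx B)%MS.
  move: rA rB; lia.
case/rowV0Pn => e; rewrite sub_capmx => /andP[/sub_kermxP eA /sub_kermxP eB] /eqP[].
exact: noker.
Qed.

Lemma vanishing_zero_pencil (f : 'rV_3) :
  vanishing f A -> vanishing f B -> zero_pencil.
Proof.
move=> fA fB; apply/zero_pencilP => s t; apply/eqP; rewrite det_rank.
apply: (vanishing_rank F2 _ (vanishing_pencil s t fA fB)).
by rewrite linearD !linearZ /= As Bs.
Qed.

Lemma ker_zero_pencil (e : 'rV_3) : e != 0 -> e *m A = 0 -> e *m B = 0 -> zero_pencil.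
Proof.
move=> en eA eB; apply/zero_pencilP => s t; apply/eqP; rewrite det_rank.
by apply: (ker_rank en); rewrite mulmxDr -!scalemxAr eA eB !scaler0 addr0.
Qed.

Definition common_ker (e : 'rV[F]_3) := (e *m A == 0) && (e *m B == 0).
Definition common_line (f : 'rV[F]_3) := vanishing f A && vanishing f B.

Lemma common_ker_sub e : common_ker e = (e <= kermx (row_mx A B))%MS.
Proof.
apply/andP/sub_kermxP; rewrite mul_mx_row; first by case=> /eqP-> /eqP->; rewrite row_mx0.
by move/eqP; rewrite row_mx_eq0 => /andP.
Qed.

Lemma common_ker_line_orth e f : (A, B) != (0, 0) ->
  common_ker e ->
  common_line f -> f *m e^T = 0.
Proof.
move=> ABn /andP[/eqP eA /eqP eB] /andP[fA fB]; apply/eqP; rewrite -trmx_eq0 trmx_mul trmxK.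
apply: contraNT ABn => ef.
by rewrite (vanishing_ker_off F2 As fA eA ef) (vanishing_ker_off F2 Bs fB eB ef).
Qed.

(** If the common kernel is a line, it has [q - 1] nonzero vectors.  If it is a plane, a
    common line component must be its orthogonal, since it passes through every
    common vertex. *)
Lemma card_common_ker_or_line e0 : (A, B) != (0, 0) -> e0 != 0 -> common_ker e0 ->
  #|[set e | (e != 0) && common_ker e]| = q.-1 \/
  #|[set f | (f != 0) && common_line f]| = q.-1.
Proof.
move=> ABn e0n e0k; set K := kermx (row_mx A B).
have KA : K *m A = 0 /\ K *m B = 0.
  have := mulmx_ker (row_mx A B); rewrite mul_mx_row => /eqP.
  by rewrite row_mx_eq0 => /andP[/eqP ? /eqP ?].
have [rK|rK] := leqP (\rank K) 1.
  left; rewrite -(@card_span1 _ _ _ K).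
    by apply: eq_card => e; rewrite !inE common_ker_sub.
  apply/eqP; rewrite eqn_leq rK lt0n mxrank_eq0; apply: contraNneq e0n => K0.
  by move: e0k; rewrite common_ker_sub -/K K0 submx0.
right; pose G := kermx K^T.
have orthG M : M^T = M -> K *m M = 0 -> (M <= G)%MS.
  by move=> Ms KM; apply/sub_kermxP; rewrite -Ms -trmx_mul KM trmx0.
have [GA GB] := (orthG A As KA.1, orthG B Bs KA.2).
have rG : \rank G = 1%N.
  have rGK : \rank G = (3 - \rank K)%N by rewrite mxrank_ker mxrank_tr.
  apply/eqP; rewrite eqn_leq {1}rGK leq_subLR addn1 ltnS rK lt0n mxrank_eq0 /=.
  apply: contraNneq ABn => G0; move: GA GB; rewrite G0 !submx0.
  by move=> /eqP-> /eqP->.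
rewrite -(card_span1 rG); apply: eq_card => f; rewrite !inE.
have [//|fn /=] := eqVneq f 0; apply/idP/idP => [fc|fG].
  apply/sub_kermxP; apply: trmx_inj; rewrite trmx_mul trmxK trmx0.
  apply/row_matrixP => i; rewrite row0 row_mul.
  apply: trmx_inj; rewrite trmx_mul trmxK trmx0; apply: common_ker_line_orth fc => //.
  by rewrite common_ker_sub row_sub.
have Gf : (G <= f)%MS by apply: sub_rank_swap fG _; rewrite rG rank_rV fn.
have van M : M^T = M -> (M <= G)%MS -> vanishing f M.
  move=> Ms MG; apply/forall_inP => v /eqP vf.
  have /sub_orthP/(_ v vf) := submx_trans MG Gf.
  by rewrite Ms /isotropic => ->; rewrite mul0mx.
by rewrite /common_line !van.
Qed.

(** Let [a] and [b] be the numbers of common vertices and common lines.  If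
    [(A, B) != 0] and [a != 0], every common line passes through every common vertex,
    so the flags number [a * b] and the identity reads
    [(a - (q - 1)) * (b - (q - 1)) = 0].  If [a = 0] it reads
    [b = (q - 1) * zero_pencil], the existence and uniqueness of a common line.
    The last term corrects the value at [(A, B) = 0]. *)
Lemma zero_pencil_indicator :
  (q.-1 ^ 2 * zero_pencil
   + \sum_(e : 'rV[F]_3 | (e != 0)%R)
      \sum_(f : 'rV[F]_3 | ((f != 0) && (f *m e^T == 0))%R) (common_ker e && common_line f)
   = q.-1 * (\sum_(e : 'rV[F]_3 | (e != 0)%R) (common_ker e : nat))
   + q.-1 * (\sum_(f : 'rV[F]_3 | (f != 0)%R) (common_line f : nat))
   + q.-1 ^ 2 * q ^ 3 * ((A, B) == (0, 0))%R)%N.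
Proof.
have [AB0|ABn] := eqVneq (A, B) (0, 0).
  have [A0 B0] := AB0.
  have ck e : common_ker e = true by rewrite /common_ker A0 B0 !mulmx0 eqxx.
  have cp f : common_line f = true.
    rewrite /common_line A0 B0 andbb; apply/forall_inP => v _.
    by rewrite /isotropic mulmx0 mul0mx.
  have zp : zero_pencil by apply/zero_pencilP => s t; rewrite A0 B0 !scaler0 addr0 det0.
  have card3 : #|[set~ 0 : 'rV[F]_3]| = (q ^ 3).-1 by rewrite cardsC1 card_mx mul1n.
  have sum3 (g : 'rV[F]_3 -> bool) : (forall e, g e) ->
      \sum_(e : 'rV[F]_3 | e != 0) (g e : nat) = (q ^ 3).-1.
    move=> gT; rewrite sum_bool -card3; apply: eq_card => e.
    by rewrite !inE gT andbT.
  rewrite zp !sum3 // muln1 (eq_bigr (fun=> (q ^ 2).-1 * true)%N) => [|e en]; last first.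
    rewrite muln1 -(card_orth en) sum_bool; apply: eq_card => f.
    by rewrite !inE ck cp !andbT.
  rewrite -big_distrr (sum3 (fun=> true)) //= predX2 predX3 expnS.
  by case: #|_| (q_gt0 F) => // m _ /=; nia.
rewrite muln0 addn0.
have [/existsP[e0 /andP[e0n e0k]]|no] := boolP [exists e, (e != 0) && common_ker e].
  have zp : zero_pencil.
    by case/andP: e0k => /eqP e0A /eqP e0B; exact: ker_zero_pencil e0A e0B.
  have -> : (\sum_(e : 'rV[F]_3 | (e != 0)%R)
      \sum_(f : 'rV[F]_3 | ((f != 0) && (f *m e^T == 0))%R) (common_ker e && common_line f) =
     (\sum_(e : 'rV[F]_3 | (e != 0)%R) (common_ker e : nat)) *
     (\sum_(f : 'rV[F]_3 | (f != 0)%R) (common_line f : nat)))%N.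
    rewrite big_distrl /=; apply: eq_bigr => e en; case ek : (common_ker e) => /=; last first.
      by rewrite mul0n big1.
    rewrite mul1n big_mkcondr /=; apply: eq_bigr => f fn.
    case: eqP => // fe; case fc : (common_line f) => //; case: fe.
    exact: (common_ker_line_orth ABn ek fc).
  rewrite zp !sum_bool.
  by case: (card_common_ker_or_line ABn e0n e0k) => ->; rewrite expnS expn1; lia.
have nok (e : 'rV[F]_3) : e != 0 -> common_ker e = false.
  by move=> en; apply: contraNF no => ek; apply/existsP; exists e; rewrite en.
rewrite big1 => [|e /nok ek]; last by rewrite big1 // => f _; rewrite ek.
rewrite addn0 big1 => [|e /nok -> //]; rewrite muln0 add0n.
have noker (e : 'rV[F]_3) : e *m A = 0 -> e *m B = 0 -> e = 0.
  move=> eA eB; have [//|/nok] := eqVneq e 0.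
  by rewrite /common_ker eA eB !eqxx.
rewrite sum_bool; have [zp|nzp] := boolP zero_pencil; last first.
  rewrite (_ : [set _ | _] = set0) ?cards0 ?muln0 //.
  apply/setP => f; rewrite !inE; apply: contraNF nzp => /and3P[_ fA fB].
  exact: vanishing_zero_pencil fA fB.
have [f0 f0n /andP[f0A f0B]] := component_exists zp noker.
rewrite muln1 expnS expn1; congr (_ * _)%N.
have rf0 : \rank f0 = 1%N by rewrite rank_rV f0n.
rewrite -(card_span1 rf0); apply: eq_card => f; rewrite !inE.
have [//|fn /=] := eqVneq f 0; apply/idP/andP => [/sub_rVP[c fE]|[fA fB]].
  have cn : c != 0 by apply: contraNneq fn => c0; rewrite fE c0 scale0r.
  have van M : vanishing f0 M -> vanishing f M.
    move=> /forall_inP h; apply/forall_inP => v; rewrite fE linearZ /= -scalemxAr.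
    by rewrite scaler_eq0 (negPf cn); exact: h.
  by split; apply: van.
exact: (vanishing_uniq F2 As Bs f0n fn).
Qed.

End ZeroResolvent.

(** * Singular pairs and their spectral norm *)

Section SingularPairs.
Variable F : finFieldType.
Hypothesis F2 : (2 : F) != 0.
Implicit Types x : tqpair F.

Lemma tqmxB (A B : tqform F) : tqmx (A - B) = tqmx A - tqmx B.
Proof.
apply/matrixP; case=> [[|[|[|i]]] hi] //; case=> [[|[|[|j]]] hj] //;
  rewrite !mxE /tqcoef /= !mxE; ring.
Qed.

Lemma resolventE x :
  let A := tqmx x.1 in let B := tqmx x.2 in
  let a := - 4 * \det A in let b := - 4 * \tr (\adj A *m B) in
  let c := - 4 * \tr (\adj B *m A) in let d := - 4 * \det B in
  resolvent x = a%:P%:P * 'X^3 + b%:P%:P * 'X^2 * ('X)%:P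
              + c%:P%:P * 'X * ('X)%:P ^+ 2 + d%:P%:P * ('X)%:P ^+ 3.
Proof.
move=> A B a b c d; rewrite /resolvent -/A -/B det_pencil.
have trE M N : \tr (\adj (map_mx (polyC \o polyC) M) *m map_mx (polyC \o polyC) N) =
    (\tr (\adj M *m N))%:P%:P :> {poly {poly F}}.
  by rewrite -map_mx_adj -map_mxM trace_map_mx.
rewrite !trE !det_map_mx /= /a /b /c /d !rmorphM /= !rmorphN /= !rmorph_nat.
ring.
Qed.

Definition pencil x (l : F * F) := l.1 *: tqmx x.1 + l.2 *: tqmx x.2.

Lemma pencil_sym x l : (pencil x l)^T = pencil x l.
Proof. by rewrite linearD !linearZ /= !tqmx_sym. Qed.

Definition dbl_member l x := dbl_pencil (pencil x l) (tqmx x.1) (tqmx x.2).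
Definition zero_resolvent x := zero_pencil (tqmx x.1) (tqmx x.2).

Lemma dblroot_pencil (A B : 'M[F]_3) l :
  dblroot (\det A) (\tr (\adj A *m B)) (\tr (\adj B *m A)) (\det B) l =
  dbl_pencil (l.1 *: A + l.2 *: B) A B.
Proof.
case: l => s t; rewrite /dblroot /dbl_pencil /=.
have -> : \tr (\adj (s *: A + t *: B) *m B) =
    cub_v (\tr (\adj A *m B)) (\tr (\adj B *m A)) (\det B) (s, t).
  rewrite (addrC (s *: A)) tr_adj_pencil /cub_v /=.
  by move: (\tr _) (\tr _) (\det B) => b c d; ring.
rewrite (det_pencil A B s t) (tr_adj_pencil A B s t) /cub /cub_u /=.
by move: (\tr _) (\tr _) (\det A) (\det B) => b c a d.
Qed.

(** The resolvent is [- 4] times the determinant of the pencil, so its discriminant is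
    multiplied by [(- 4) ^+ 4 = 2 ^+ 8], a unit. *)
Lemma singular_count x :
  (#|F|.-1 * singular x + #|F|.-1 * #|F| * zero_resolvent x =
   \sum_(l : F * F | (l != 0)%R) dbl_member l x)%N.
Proof.
rewrite -mulnA -mulnDr sum_bool; set A := tqmx x.1; set B := tqmx x.2.
pose a := \det A; pose b := \tr (\adj A *m B); pose c := \tr (\adj B *m A).
pose d := \det B.
have sE : singular x = (bcdisc a b c d == 0).
  rewrite /singular /Disc resolventE cubic_discE -/A -/B -/a -/b -/c -/d.
  rewrite -[X in _ = X](mulrI_eq0 _ (mulfI (expf_neq0 8 F2))).
  by congr (_ == 0); rewrite /bcdisc; ring.
rewrite sE -card_dblroot //; apply: eq_card => l; rewrite !inE; congr (_ && _).
exact: dblroot_pencil.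
Qed.

End SingularPairs.

Section Subgroups.
Variable F : finFieldType.
Implicit Types (W : tqpair F -> bool).

Definition subgroup W := W 0 /\ forall x y, W x -> W y -> W (x - y).

Lemma subgroup_ker (V : zmodType) (phi : tqpair F -> V) :
  {morph phi : x y / x - y} -> subgroup (fun x => phi x == 0).
Proof.
move=> phiB; split=> [|x y /eqP x0 /eqP y0]; last by rewrite phiB x0 y0 subrr.
by rewrite -[X in phi X](subrr 0) phiB subrr.
Qed.

Lemma subgroupI W W' : subgroup W -> subgroup W' -> subgroup (fun x => W x && W' x).
Proof.
move=> [W0 WB] [W'0 W'B]; split=> [|x y /andP[Wx W'x] /andP[Wy W'y]].
  by rewrite W0 W'0.
by rewrite WB ?W'B.
Qed.

Lemma subgroup_forall (T : finType) (Q : pred T) (W : T -> tqpair F -> bool) :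
  (forall i, subgroup (W i)) -> subgroup (fun x => [forall i, Q i ==> W i x]).
Proof.
move=> sW; split=> [|x y /forall_inP Wx /forall_inP Wy]; apply/forall_inP => i Qi.
  by case: (sW i).
by case: (sW i) => _; apply; [exact: Wx | exact: Wy].
Qed.

Lemma tqmx1B : {morph (fun x : tqpair F => tqmx x.1) : x y / x - y}.
Proof. by move=> x y; exact: tqmxB. Qed.

Lemma tqmx2B : {morph (fun x : tqpair F => tqmx x.2) : x y / x - y}.
Proof. by move=> x y; exact: tqmxB. Qed.

Lemma pencilB l : {morph (fun x : tqpair F => pencil x l) : x y / x - y}.
Proof.
move=> x y /=; rewrite /pencil tqmx1B tqmx2B !scalerBr opprD.
by rewrite addrACA.
Qed.

Variable M_ : tqpair F -> 'M[F]_3.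
Hypothesis MB : {morph M_ : x y / x - y}.

Lemma subgroup_kermx n (e : 'M[F]_(n, 3)) : subgroup (fun x => e *m M_ x == 0).
Proof. by apply: subgroup_ker => x y; rewrite MB mulmxBr. Qed.

Lemma subgroup_isotropic (e : 'rV[F]_3) : subgroup (fun x => isotropic (M_ x) e).
Proof. by apply: subgroup_ker => x y; rewrite MB mulmxBr mulmxBl. Qed.

Lemma subgroup_submx (f : 'rV[F]_3) : subgroup (fun x => (M_ x <= f)%MS).
Proof.
have [s0 sB] : subgroup (fun x => M_ x *m cokermx f == 0).
  by apply: subgroup_ker => x y; rewrite MB mulmxBl.
by split=> [|x y]; rewrite !submxE //; exact: sB.
Qed.

Lemma subgroup_eq0 : subgroup (fun x => M_ x == 0).
Proof. exact: subgroup_ker. Qed.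

Lemma subgroup_vanishing (f : 'rV[F]_3) : subgroup (fun x => vanishing f (M_ x)).
Proof. by apply: subgroup_forall => v; exact: subgroup_isotropic. Qed.

End Subgroups.

Section Bounds.
Variables (R : realType) (F : finFieldType) (p : nat).
Variable pcharF : p \in [pchar F].
Hypothesis p_neq2 : p != 2%N.
Notation q := #|F|.
Implicit Types (phi : tqpair F -> nat) (N M k : nat).

(** Natural number values suffice: the identities to be exploited
    count vectors, and subtraction is confined to [wbound_div]. *)
Definition wbound phi N := wnorm pcharF (fun x => (phi x)%:R : R[i]) <= N%:R.

Lemma wbound_subgroup (W : tqpair F -> bool) : subgroup W -> wbound W 1.
Proof.
move=> [W0 WB]; rewrite /wbound -[leLHS](_ : wnorm pcharF (fun x => (x \in W)%:R) = _) //.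
by rewrite wnorm_subgroup.
Qed.

Lemma wboundD (f g : tqpair F -> nat) N M :
  wbound f N -> wbound g M -> wbound (fun x => f x + g x)%N (N + M).
Proof.
move=> fN gM; rewrite /wbound natrD; apply: le_trans (lerD fN gM).
rewrite (@eq_wnorm _ _ _ _ _ (fun x => (f x)%:R + (g x)%:R)) ?wnormD // => x.
by rewrite natrD.
Qed.

Lemma wboundM k (f : tqpair F -> nat) N :
  wbound f N -> wbound (fun x => k * f x)%N (k * N).
Proof.
move=> fN; rewrite /wbound (@eq_wnorm _ _ _ _ _ (fun x => k%:R * (f x)%:R)).
  by rewrite wnormZ normr_nat natrM ler_wpM2l.
by move=> x; rewrite natrM.
Qed.

Lemma wbound_sum (I : finType) (P : pred I) (f_ : I -> tqpair F -> nat) N k :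
  (#|P| <= k)%N -> (forall i, P i -> wbound (f_ i) N) ->
  wbound (fun x => \sum_(i | P i) f_ i x)%N (k * N).
Proof.
move=> Pk fN; rewrite /wbound.
rewrite (@eq_wnorm _ _ _ _ _ (fun x => \sum_(i | P i) (f_ i x)%:R)) => [|x].
  apply: le_trans (wnorm_sum _ _ _) _; apply: le_trans (ler_sum _ fN) _.
  by rewrite sumr_const -mulrnA ler_nat mulnC leq_mul2r Pk orbT.
by rewrite natr_sum.
Qed.

(** How a counting identity bounds an unknown indicator function [f]: subtract and
    divide. *)
Lemma wbound_div k (f g h : tqpair F -> nat) N M M' : (0 < k)%N ->
  (forall x, k * f x + g x = h x)%N -> wbound g M -> wbound h M' ->
  (M + M' <= k * N)%N -> wbound f N.
Proof.
move=> k0 E gM hM' le; rewrite /wbound -(ler_pM2l (_ : 0 < k%:R)) ?ltr0n //.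
rewrite -[X in X * _]normr_nat -wnormZ.
rewrite (@eq_wnorm _ _ _ _ _ (fun x => (h x)%:R + -1 * (g x)%:R)) => [|x].
  apply: le_trans (wnormD _ _ _) _; rewrite wnormZ normrN1 mul1r addrC.
  by apply: le_trans (lerD gM hM') _; rewrite -natrD -natrM ler_nat.
by rewrite -E natrD natrM; ring.
Qed.

Lemma q_le_double : (q <= 2 * q.-1)%N.
Proof. by have := finNzRing_gt1 F; case: #|_| => [|[|m]] //= _; lia. Qed.

(** Division by [(q - 1) ^ 2] costs at most a factor 4. *)
Lemma q_bound M : (M <= 6 * q ^ 5)%N -> (M <= q.-1 ^ 2 * (24 * q ^ 3))%N.
Proof.
move/leq_trans; apply; rewrite (expnD q 2 3) !mulnA leq_mul2r; apply/orP; right.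
by have := leq_mul q_le_double q_le_double; rewrite -!mulnn; nia.
Qed.

Lemma card_nz3 : (#|[pred e : 'rV[F]_3 | (e != 0)%R]| <= q ^ 3)%N.
Proof. by apply: leq_trans (max_card _) _; rewrite card_mx mul1n. Qed.

Lemma card_flag (e : 'rV[F]_3) : e != 0 ->
  (#|[pred f : 'rV[F]_3 | ((f != 0) && (f *m e^T == 0))%R]| <= q ^ 2)%N.
Proof.
move=> en; rewrite -[X in (X <= _)%N]cardsE card_orth //=; exact: leq_pred.
Qed.

Lemma wbound_dbl_member l : wbound (dbl_member l) (24 * q ^ 3).
Proof.
pose P x := pencil x l.
pose A (x : tqpair F) := tqmx x.1; pose B (x : tqpair F) := tqmx x.2.
have E x := dbl_pencil_indicator (pencil_sym x l) (A x) (B x).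
have iso e : subgroup (fun x => isotropic (A x) e && isotropic (B x) e).
  by apply: subgroupI; apply: subgroup_isotropic; [exact: tqmx1B | exact: tqmx2B].
have s1 e : subgroup (fun x => [&& e *m P x == 0, isotropic (A x) e & isotropic (B x) e]).
  by apply: subgroupI (iso e); apply: subgroup_kermx; exact: pencilB.
have s2 (f : 'rV[F]_3) : subgroup (fun x => (P x <= f)%MS).
  by apply: subgroup_submx; exact: pencilB.
have s4 : subgroup (fun x => P x == 0) by apply: subgroup_eq0; exact: pencilB.
have s5 e : subgroup (fun x => [&& P x == 0, isotropic (A x) e & isotropic (B x) e]).
  exact: subgroupI s4 (iso e).
have s3 e (f : 'rV[F]_3) :
    subgroup (fun x => [&& (P x <= f)%MS, isotropic (A x) e & isotropic (B x) e]).
  exact: subgroupI (s2 f) (iso e).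
have W1 := wbound_sum card_nz3 (fun e _ => wbound_subgroup (s1 e)).
have W2 := wbound_sum card_nz3 (fun f _ => wbound_subgroup (s2 f)).
have W3 := wbound_sum card_nz3 (fun e en =>
  wbound_sum (card_flag en) (fun f _ => wbound_subgroup (s3 e f))).
have W4 := wbound_subgroup s4.
have W5 := wbound_sum card_nz3 (fun e _ => wbound_subgroup (s5 e)).
have G := wboundD W3 (wboundM (q.-1 ^ 2 * (q ^ 2 + q)) W4).
have H := wboundD (wboundD (wboundM q.-1 W1) (wboundM q.-1 W2)) (wboundM (q.-1 * q) W5).
apply: (wbound_div _ _ G H); last first.
- apply: q_bound; rewrite !muln1.
  have mq : (q.-1 <= q)%N := leq_pred q.
  have q1 : (0 < q)%N := q_gt0 F.
  rewrite !expnS expn0 !muln1; move: mq q1; set m := q.-1; set n := q => mq q1.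
  nia.
- by move=> x; rewrite addnA; exact: E.
- by rewrite expn_gt0 -subn1 subn_gt0 finNzRing_gt1.
Qed.

Lemma wbound_zero_resolvent : wbound (@zero_resolvent F) (24 * q ^ 3).
Proof.
have F2 := two_neq0 pcharF p_neq2.
pose A (x : tqpair F) := tqmx x.1; pose B (x : tqpair F) := tqmx x.2.
have E x := zero_pencil_indicator F2 (tqmx_sym x.1) (tqmx_sym x.2).
have s1 e : subgroup (fun x => common_ker (A x) (B x) e).
  by apply: subgroupI; apply: subgroup_kermx; [exact: tqmx1B | exact: tqmx2B].
have s2 (f : 'rV[F]_3) : subgroup (fun x => common_line (A x) (B x) f).
  by apply: subgroupI; apply: subgroup_vanishing; [exact: tqmx1B | exact: tqmx2B].
have s3 e (f : 'rV[F]_3) :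
    subgroup (fun x => common_ker (A x) (B x) e && common_line (A x) (B x) f).
  exact: subgroupI.
have s4 : subgroup (fun x => (A x, B x) == (0, 0)).
  by apply: subgroupI; apply: subgroup_eq0; [exact: tqmx1B | exact: tqmx2B].
have W1 := wbound_sum card_nz3 (fun e _ => wbound_subgroup (s1 e)).
have W2 := wbound_sum card_nz3 (fun f _ => wbound_subgroup (s2 f)).
have W3 := wbound_sum card_nz3 (fun e en =>
  wbound_sum (card_flag en) (fun f _ => wbound_subgroup (s3 e f))).
have W4 := wbound_subgroup s4.
have H := wboundD (wboundD (wboundM q.-1 W1) (wboundM q.-1 W2))
  (wboundM (q.-1 ^ 2 * q ^ 3) W4).
apply: (wbound_div _ _ W3 H); last first.
- apply: q_bound; rewrite !muln1.
  have mq : (q.-1 <= q)%N := leq_pred q.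
  have q1 : (0 < q)%N := q_gt0 F.
  rewrite !expnS expn0 !muln1; move: mq q1; set m := q.-1; set n := q => mq q1.
  nia.
- by move=> x; exact: E.
- by rewrite expn_gt0 -subn1 subn_gt0 finNzRing_gt1.
Qed.

Lemma wbound_singular : wbound (@singular F) (96 * q ^ 4).
Proof.
have F2 := two_neq0 pcharF p_neq2.
have card2 : (#|[pred l : F * F | (l != 0)%R]| <= q ^ 2)%N.
  by apply: leq_trans (max_card _) _; rewrite card_prod mulnn.
have Z := wboundM (q.-1 * q) wbound_zero_resolvent.
have H := wbound_sum card2 (fun l _ => wbound_dbl_member l).
apply: (wbound_div (k := q.-1) _ _ Z H); last first.
- have -> : (q.-1 * q * (24 * q ^ 3) + q ^ 2 * (24 * q ^ 3) =
      (24 * q.-1 + 24 * q) * q ^ 4)%N.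
    by ring.
  rewrite [leqRHS]mulnA leq_mul2r; apply/orP; right.
  by have := q_le_double; lia.
- by move=> x; exact: singular_count.
- by rewrite -subn1 subn_gt0 finNzRing_gt1.
Qed.

End Bounds.

Theorem corollary3 (R : realType) :
  exists C : R, 0 < C /\
    forall (F : finFieldType) (p : nat) (pcharF : p \in [pchar F]),
      p != 2%N ->
      \sum_(x : tqpair F) `|fourier pcharF (@singular_char R F) x|
        <= C%:C * #|F|%:R ^+ 4.
Proof.
exists 96%:R; split=> [|F p pcharF p_neq2]; first by rewrite ltr0n.
rewrite rmorph_nat -natrX -natrM; exact: (wbound_singular R pcharF p_neq2).
Qed.
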